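(* Let $G$ be an infinite metrizable profinite group such that $\operatorname{non}(\mathcal{N})\le\mathfrak{fm}(G)$, where $\operatorname{non}(\mathcal{N})$ is the minimal cardinality of a non-null subset of the Cantor space and $\mathfrak{fm}(G)$ is the Fubini--Markov number of $G$. Then $G$ has a subgroup that is not Haar measurable.
   Context: Let $G$ be an infinite metrizable profinite group with identity element $e$ and Haar probability measure $\mu$. For each natural number $n\ge 1$, the Haar probability measure of $G^n$ is the product measure, also denoted $\mu$. ''Null'' and ''measurable'' refer to (the completion of) this measure; a set has full measure if its complement is null. Words. Let $X=\{x_1,x_2,\dots\}$ be a countable set of variables, and let $G[X]$ be the set of all words in the alphabet $G\cup\{x_1^{\pm1},x_2^{\pm1},\dots\}$. For $w\in G[X]$, let $|w|$ be the (finite) number of variables occurring in $w$; the set $G[X]\setminus G$ consists of the words in which at least one variable occurs. A word $w\in G[X]\setminus G$ whose variables are $x_{i_1},\dots,x_{i_n}$ ($i_1<\dots<i_n$, $n=|w|$) is viewed as a continuous function $w\colon G^{n}\to G$, defined by substituting group elements for the variables and multiplying in $G$. Markov sets. A Markov set is a set of the form $w^{-1}(e)=\{h\in G^{|w|}: w(h)=e\}$ for some $w\in G[X]\setminus G$; it is a subset of $G^{|w|}$. A Markov null set is a Markov subset of some finite power $G^n$ that is null with respect to $\mu$. Fibers. For $n\ge2$, $A\subseteq G^n$ and $g\in G$, let $A_g:=\{h\in G^{n-1}:(h,g)\in A\}$. Fubini--Markov sets. A set $N\subseteq G$ is Fubini--Markov if either (1) $N$ is a Markov null subset of $G$, or (2)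 there are a natural number $n\ge2$ and a Markov null set $A\subseteq G^n$ such that $N=\{g\in G:\mu(A_g)>0\}$. Fubini--Markov number. $\mathfrak{fm}(G)$ is the minimal number (cardinality) of Fubini--Markov sets in $G$ whose union has full measure. $\mathcal{N}$ is the ideal of Lebesgue null subsets of the Cantor space $\{0,1\}^{\mathbb{N}}$ (with the standard product probability measure). *)

(* Defs.v *)
From HB Require Import structures.
From mathcomp Require Import all_boot all_order all_algebra.
From mathcomp Require Import all_classical all_reals all_analysis.
From mathcomp Require Import measurable_realfun.

Set Implicit Arguments.
Unset Strict Implicit.
Unset Printing Implicit Defensive.

Import Order.TTheory GRing.Theory Num.Theory.

Local Open Scope classical_set_scope.
Local Open Scope card_scope.

HB.mixin Record isTopologicalGroup G & PointedTopological G & Group G := {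
  mulg_continuous : continuous (fun x : G * G => (x.1 * x.2)%g);
  invg_continuous : continuous (fun x : G => (x^-1)%g)
}.

(* The distinguished point is only there because [g_sigma_algebraType] requires
   a pointed type; it plays no role. *)
#[short(type="topologicalGroupType")]
HB.structure Definition TopologicalGroup :=
  {G of PointedTopological G & Group G & isTopologicalGroup G}.

Definition profinite (G : topologicalGroupType) : Prop :=
  [/\ compact [set: G], hausdorff_space G & totally_disconnected [set: G]].

Definition metrizable (R : realType) (T : topologicalType) : Prop :=
  exists d : T -> T -> R,
    [/\ forall x, d x x = 0%R,
        forall x y, d x y = 0%R -> x = y,
        forall x y, d x y = d y x,
        forall x y z, (d x z <= d x y + d y z)%R &
        forall x : T, nbhs x = nbhs_ball_ (fun y e => [set z | (d y z < e)%R]) x].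

Notation borel T := (g_sigma_algebraType (@open T)).

Definition is_haar (R : realType) (G : topologicalGroupType)
    (mu : probability (borel G) R) : Prop :=
  forall (g : G) (A : set (borel G)), measurable A ->
    mu [set (g * a)%g | a in A] = mu A.

(* Despite its name, [completed_algebra_gen mu], which consists of the unions of
   a Borel set and a [mu]-negligible set, is already the whole completion. *)
Definition is_haar_measurable (R : realType) (G : topologicalGroupType)
    (mu : probability (borel G) R) (A : set G) : Prop :=
  completed_algebra_gen mu A.

Section power_measure.
Context d (T : measurableType d) (R : realType) (P : probability T R).

Definition snoc n (p : n.-tuple T * T) : n.+1.-tuple T := [tuple of rcons p.1 p.2].

Lemma tnth_snoc_max n (p : n.-tuple T * T) : tnth (snoc p) ord_max = p.2.
Proof. by rewrite (tnth_nth p.2) /= nth_rcons size_tuple ltnn eqxx. Qed.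

Lemma tnth_snoc_widen n (p : n.-tuple T * T) (i : 'I_n) :
  tnth (snoc p) (widen_ord (leqnSn n) i) = tnth p.1 i.
Proof. by rewrite !(tnth_nth p.2) /= nth_rcons size_tuple ltn_ord. Qed.

Lemma measurable_snoc n : measurable_fun [set: n.-tuple T * T] (@snoc n).
Proof.
apply/measurable_fun_tnthP => i.
have [[j ->]|->] : (exists j, i = widen_ord (leqnSn n) j) \/ i = ord_max.
- have [iltn|nlei] := ltnP i n.
    by left; exists (Ordinal iltn); exact: val_inj.
  right; apply/val_inj/eqP; rewrite /= eqn_leq nlei andbT.
  by rewrite -ltnS ltn_ord.
- rewrite (_ : _ \o _ = (@tnth n T ^~ j) \o fst); last first.
    by apply/funext => p /=; exact: tnth_snoc_widen.
  by apply: measurableT_comp => //; exact: measurable_tnth.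
- rewrite (_ : _ \o _ = snd) //.
  by apply/funext => p /=; exact: tnth_snoc_max.
Qed.

HB.instance Definition _ n := isMeasurableFun.Build _ _ _ _ _ (@measurable_snoc n).

Fixpoint power_measure n : probability (n.-tuple T) R :=
  if n is n'.+1 then distribution (power_measure n' \x P)%E (@snoc n')
  else dirac [tuple].

Lemma power_measure_setX n (A : 'I_n -> set T) : (forall i, measurable (A i)) ->
  power_measure n [set h | forall i, A i (tnth h i)] = (\prod_(i < n) P (A i))%E.
Proof.
elim: n A => [|n IHn] A mA /=.
  by rewrite big_ord0 diracE mem_set// => -[].
rewrite big_ord_recr /= -IHn// -product_measure1E//; last first.
  rewrite (_ : [set h | _] =
      \bigcap_(i in [set: 'I_n])
        ((@tnth n T ^~ i) @^-1` A (widen_ord (leqnSn n) i))).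
    by apply: fin_bigcap_measurable => // i _; rewrite -[X in measurable X]setTI;
      exact: measurable_tnth.
  by apply/seteqP; split => h /= + i; [move=> /(_ i)|move=> /(_ i I)].
rewrite /distribution /pushforward; congr (_ _).
apply/seteqP; split => -[h g] /= H.
  split=> [i|].
    by have := H (widen_ord (leqnSn n) i); rewrite tnth_snoc_widen.
  by have := H ord_max; rewrite tnth_snoc_max.
case: H => Hh Hg i.
have [iltn|nlei] := ltnP i n.
  have -> : i = widen_ord (leqnSn n) (Ordinal iltn) by exact: val_inj.
  by rewrite tnth_snoc_widen; exact: Hh.
have -> : i = ord_max.
  by apply/val_inj/eqP; rewrite /= eqn_leq nlei andbT -ltnS ltn_ord.
by rewrite tnth_snoc_max.
Qed.

End power_measure.

Section words.
Variable G : groupType.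

(* [inl g] is the constant [g], [inr (i, false)] is the variable [x_i] and
   [inr (i, true)] is its formal inverse. *)
Definition word : Type := seq (G + nat * bool).

Definition word_vars (w : word) : seq nat :=
  sort leq (undup (pmap (fun l => if l is inr (i, _) then Some i else None) w)).

Definition word_arity (w : word) : nat := size (word_vars w).

(* The variables of [w], in increasing order of their indices, are replaced with
   the successive entries of [h]; only meaningful if [size h = word_arity w]. *)
Definition word_eval (w : word) (h : seq G) : G :=
  let val i := nth 1%g h (index i (word_vars w)) in
  (\big[*%g/1]_(l <- w) match l with
                        | inl g => g
                        | inr (i, inverted) => if inverted then (val i)^-1 else val i
                        end)%g.

(* [word_arity w > 0] expresses that [w] is not a constant word. *)
Definition is_markov n (A : set (n.-tuple G)) : Prop :=
  exists w : word, [/\ (0 < word_arity w)%N, word_arity w = n &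
    A = [set h : n.-tuple G | word_eval w h = 1%g]].

End words.

Section fubini_markov.
Context (R : realType) (G : topologicalGroupType) (mu : probability (borel G) R).

Definition is_markov_null n (A : set (n.-tuple G)) : Prop :=
  is_markov A /\ (power_measure mu n).-negligible A.

Definition fiber n (A : set (n.+1.-tuple G)) (g : G) : set (n.-tuple G) :=
  [set h : n.-tuple G | A [tuple of rcons h g]].

Definition is_fubini_markov (N : set G) : Prop :=
  (exists2 A : set (1.-tuple G), is_markov_null A & N = [set g | A [tuple g]]) \/
  (exists n (A : set (n.+1.-tuple G)), [/\ (2 <= n.+1)%N, is_markov_null A &
    N = [set g | (0 < power_measure mu n (fiber A g))%E]]).

Definition fubini_markov_covers : set (set (set G)) :=
  [set F | (forall N, F N -> is_fubini_markov N) /\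
           mu.-negligible (~` \bigcup_(N in F) N)].

End fubini_markov.

(* The values on cylinders determine the fair product measure on Borel sets. *)
Definition is_coin_measure (R : realType)
    (lambda : probability (borel cantor_space) R) : Prop :=
  forall n (s : n.-tuple bool),
    lambda [set x : cantor_space | forall i : 'I_n, x i = tnth s i]
    = ((2^-1) ^+ n)%:E%R.

Definition nonnull_sets (R : realType)
    (lambda : probability (borel cantor_space) R) : set (set cantor_space) :=
  [set X | ~ lambda.-negligible X].

Definition min_card T (C : set (set T)) (A : set T) : Prop :=
  C A /\ forall B, C B -> A #<= B.

(* The least cardinality of a member of [C] is at most that of a member of [D];
   such minima exist as soon as [C] and [D] are nonempty. *)
Definition min_card_le T U (C : set (set T)) (D : set (set U)) : Prop :=
  exists A B, [/\ min_card C A, min_card D B & A #<= B].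

(* Main.v *)
Require Import Defs.
From HB Require Import structures.
From mathcomp Require Import finmap.
From mathcomp Require Import all_boot all_order all_algebra.
From mathcomp Require Import all_classical all_reals all_analysis.
From mathcomp Require wochoice.
From mathcomp Require Import ring lra.

(** A subgroup [H] of [G] that is Haar measurable and not null contains a
    neighbourhood of [1], by Steinhaus's theorem ([steinhaus],
    [haar_measurable_subgroup]). So it suffices to find a subgroup that is not
    null and contains no nonempty open set. Let [A] be a non-null subset of the
    Cantor space of least cardinality.

    If [A] has less than continuum many elements ([nonmeasurable_small]), it is
    carried to [G] by a map that sends the coin-tossing measure to the Haar measure
    ([coin_transport]). The image generates a non-null subgroup with less than
    continuum many elements ([card_le_over], from Hessenberg's theorem
    [card_le_setX_self]). An open set in it would have finitely many translates
    covering [G], which has the cardinality of the continuum, as [G] is homeomorphic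
    to the Cantor space ([card_ge_cantor_group]).

    Otherwise no family of less than continuum many Fubini-Markov sets has a union
    of full measure ([nonmeasurable_continuum]). As the fibers of a map have positive
    measure for countably many values only, there are constants [g k], dense in [G],
    such that all the equations [w = g k], for words [w] without constants, have null
    solution sets ([generic_constants]). Generators [x t] are then chosen
    recursively, along a well-order of the continuum whose proper initial segments
    are smaller ([initial_well_order]). The invariant is that the equations
    [w = g k] have null solution sets also for words [w] with constants among the
    [x s] already chosen. When [x t] is added as a constant, the solution set of
    such an equation is the fiber at [x t] of the solution set of an equation over
    the previous constants, with one variable more; the former is null unless [x t]
    belongs to the Fubini-Markov set of the latter ([null_equation_abstract],
    [generic_null_equation]). There are less than continuum many such sets at each
    stage, so that the complement of their union is not null, and [x t] can be
    chosen in it outside of a prescribed null set. There are enough stages to treat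
    in this way all the null [G_delta] sets ([null_sets_coded]), so that
    the set of all [x t] is not null. The invariant for words without variables says
    that the subgroup generated by the [x t] contains no [g k]; as these are dense,
    it contains no nonempty open set. *)

Set Implicit Arguments.
Unset Strict Implicit.
Unset Printing Implicit Defensive.

Import Order.TTheory GRing.Theory Num.Theory.
Import numFieldNormedType.Exports.

Local Open Scope classical_set_scope.
Local Open Scope card_scope.

(** * Cardinal arithmetic *)

Lemma card_le_rel T U (A : set T) (B : set U) (G : T -> U -> Prop) :
  (forall a, A a -> exists2 b, B b & G a b) ->
  (forall a a' b, A a -> A a' -> G a b -> G a' b -> a = a') -> A #<= B.
Proof.
elim/Ppointed: U => U in B G * => totG injG.
  have -> : A = set0 by apply/seteqP; split=> // a /totG[b]; rewrite (empty_eq0 B).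
  exact: card_ge0.
have /choice[f fP] : forall a, exists b, A a -> B b /\ G a b.
  move=> a; have [/totG[b Bb Gab]|nAa] := pselect (A a); first by exists b.
  by exists point.
apply/pcard_leP.
have fAB : set_fun A B f by move=> a /fP[].
have finj : {in A &, injective f}.
  move=> a a' /set_mem Aa /set_mem Aa' faa'; apply: (injG a a' (f a)) => //.
    by have [] := fP _ Aa.
  by rewrite faa'; have [] := fP _ Aa'.
by rewrite injfunPex; exists f.
Qed.

Lemma card_leP_ex T (U : pointedType) (A : set T) (B : set U) :
  A #<= B -> exists f : T -> U, (forall a, A a -> B (f a)) /\
    (forall a a', A a -> A a' -> f a = f a' -> a = a').
Proof.
move=> /pcard_leP[f]; exists f; split=> [a Aa|a a' Aa Aa' e].
  exact: (@funS _ _ _ _ f).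
by apply: (@inj _ _ _ f) e; exact: mem_set.
Qed.

(** Comparability of cardinals: a maximal partial injection between two sets
    has full domain or full range. *)
Lemma card_le_total T U (A : set T) (B : set U) : A #<= B \/ B #<= A.
Proof.
(* Partial injections, as graphs. *)
pose P (G : set (T * U)) := G `<=` A `*` B /\
  forall p q, G p -> G q -> (p.1 = q.1) <-> (p.2 = q.2).
have [F FP totF|G [[GAB Ginj] Gmax]] := @Zorn_bigcup _ P.
  split=> [p [X FX Xp]|p q [X FX Xp] [Y FY Yq]].
    by have [+ _] := FP _ FX; apply.
  have [XY|YX] := totF _ _ FX FY.
    by have [_] := FP _ FY; apply=> //; exact: XY.
  by have [_] := FP _ FX; apply=> //; exact: YX.
have [domG|/existsNP[a /not_implyP[Aa /forallNP na]]] :=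
    pselect (forall a, A a -> exists b, G (a, b)).
  left; apply: (@card_le_rel _ _ _ _ (fun a b => G (a, b))).
    by move=> a /domG[b Gab]; exists b => //; have [] := GAB _ Gab.
  by move=> a a' b _ _ Gab Ga'b; apply/(Ginj (a, b) (a', b)).
right; apply: (@card_le_rel _ _ _ _ (fun b a => G (a, b))).
  move=> b Bb; apply: contrapT => nb.
  have {}nb a' : ~ G (a', b).
    by move=> Ga'b; apply: nb; exists a' => //; have [] := GAB _ Ga'b.
  apply: (Gmax (G `|` [set (a, b)])).
    split=> [p|]; first by left.
    by move=> /(_ (a, b) (or_intror erefl)); exact: na.
  split=> [p [/GAB//|-> //]|p q [Gp|->] [Gq|->]] //; first exact: Ginj.
    split=> /= e; first by case: (na p.2); rewrite -e -surjective_pairing.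
    by case: (nb p.1); rewrite -e -surjective_pairing.
  split=> /= e; first by case: (na q.2); rewrite e -surjective_pairing.
  by case: (nb q.1); rewrite e -surjective_pairing.
by move=> b b' x _ _ Gxb Gxb'; apply/(Ginj (x, b) (x, b')).
Qed.

(** Hessenberg's theorem. Among the injections [D `*` D -> D] with [D] an
    infinite subset of [A], coded as relations, a maximal one exists. Its domain
    has the cardinality of [A]: otherwise [A `\` D] has a copy [k @` D] of [D], and
    the three parts of [(D `|` k @` D) `*` (D `|` k @` D)] outside of [D `*` D]
    inject together into that copy. *)
Lemma card_le_setX_self (T : Type) (A : set T) :
  infinite_set A -> A `*` A #<= A.
Proof.
elim/Ppointed: T => T in A *; first by rewrite emptyE_subdef.
move=> infA.
pose dom (G : set ((T * T) * T)) := [set x | exists z, G ((x, x), z)].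
pose P G := [/\ G !=set0 -> infinite_set (dom G), dom G `<=` A,
  forall x y, dom G x -> dom G y -> exists z, G ((x, y), z),
  forall p z, G (p, z) -> [/\ dom G p.1, dom G p.2 & dom G z] &
  forall p q z, G (p, z) -> G (q, z) -> p = q].
have domS G G' : G `<=` G' -> dom G `<=` dom G'.
  by move=> GG' x [z Gz]; exists z; exact: GG'.
have [F FP totF|G [PG Gmax]] := @Zorn_bigcup _ P.
  have FS X : F X -> dom X `<=` dom (\bigcup_(X in F) X).
    by move=> FX; apply: domS; exact: bigcup_sup.
  split=> [[p [X FX Xp]]|x [z [X FX Xz]]|x y [z [X FX Xz]] [z' [Y FY Yz']]
          |p z [X FX Xz]|p q z [X FX Xz] [Y FY Yz]].
  - have [+ _ _ _ _] := FP _ FX => /(_ (ex_intro _ p Xp)).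
    exact/sub_infinite_set/FS.
  - by have [_ + _ _ _] := FP _ FX; apply; exists z.
  - have [XY|YX] := totF _ _ FX FY.
      have [_ _ + _ _] := FP _ FY => /(_ x y)[||t Yt]; last by exists t, Y.
        by exists z; exact: XY.
      by exists z'.
    have [_ _ + _ _] := FP _ FX => /(_ x y)[||t Xt]; last by exists t, X.
      by exists z.
    by exists z'; exact: YX.
  - have [_ _ _ + _] := FP _ FX => /(_ _ _ Xz)[? ? ?].
    by split; exact: FS FX _ _.
  - have [XY|YX] := totF _ _ FX FY.
      by have [_ _ _ _] := FP _ FY; apply; [exact: XY Xz|exact: Yz].
    by have [_ _ _ _] := FP _ FX; apply; [exact: Xz|exact: YX Yz].
have [h [hA hinj]] : exists h : nat -> T, (forall i, A (h i)) /\ injective h.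
  have /infiniteP/card_leP_ex[h [hA hinj]] := infA.
  by exists h; split=> [i|i j]; [exact: hA|exact: hinj].
have G0 : G !=set0.
  apply: contrapT => /set0P/negP/negPn/eqP G0.
  pose H := [set ((h ij.1, h ij.2), h (pickle ij)) | ij in [set: nat * nat]].
  have domH : dom H = range h.
    apply/seteqP; split=> [x [z [[i j] _ [<- _ _]]]|_ [i _ <-]]; first by exists i.
    by exists (h (pickle (i, i))), (i, i).
  apply: (Gmax H).
    rewrite G0; split=> // /(_ ((h 0%N, h 0%N), h (pickle (0%N, 0%N)))).
    by apply; exists (0%N, 0%N).
  split; rewrite ?domH.
  - move=> _; apply/infiniteP/(@card_le_rel _ _ _ _ (fun i x => x = h i)).
      by move=> i _; exists (h i) => //; exists i.
    by move=> i j _ _ _ -> /hinj.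
  - by move=> _ [i _ <-].
  - by move=> _ _ [i _ <-] [j _ <-]; exists (h (pickle (i, j))), (i, j).
  - by move=> p z [[i j] _ [<- <-]]; split; eexists.
  - move=> p q z [ij _ [<- <-]] [kl _ [<- /hinj]].
    by move=> /(pcan_inj pickleK) ->.
have [/(_ G0) infD DA totG GD Ginj] := PG.
set D := dom G in infD DA totG GD.
have DD : D `*` D #<= D.
  apply: (@card_le_rel _ _ _ _ (fun p z => G (p, z))) => [p [Dp1 Dp2]|p q z _ _].
    rewrite [p]surjective_pairing; have [z Gz] := totG _ _ Dp1 Dp2.
    by exists z => //; have [] := GD _ _ Gz.
  exact: Ginj.
have [p [pD pinj]] := card_leP_ex DD.
have pinj2 x y x' y' : p (x, y) = p (x', y') ->
    D x -> D y -> D x' -> D y' -> x = x' /\ y = y'.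
  move=> e Dx Dy Dx' Dy'.
  by have [] := pinj (x, y) (x', y') (conj Dx Dy) (conj Dx' Dy') e.
have [d [dD dinj]] : exists d : nat -> T, (forall i, D (d i)) /\ injective d.
  have /infiniteP/card_leP_ex[d [dD dinj]] := infD.
  by exists d; split=> [i|i j]; [exact: dD|exact: dinj].
have [/card_leP_ex[k [kD kinj]]|/card_leP_ex[k [kD kinj]]] :=
    card_le_total (A `\` D) D.
  suff AD : A #<= D.
    have [q [qD qinj]] := card_leP_ex AD.
    apply: card_le_trans (subset_card_le DA).
    apply: (@card_le_rel _ _ _ _ (fun xy z => z = p (q xy.1, q xy.2))).
      move=> [x y] [/= Ax Ay]; exists (p (q x, q y)) => //.
      by apply: pD; split; exact: qD.
    move=> [x y] [x' y'] z [/= Ax Ay] [/= Ax' Ay'] ->.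
    move=> /pinj2 /(_ (qD _ Ax) (qD _ Ay) (qD _ Ax') (qD _ Ay'))[].
    by move=> /qinj -> // /qinj ->.
  apply: (@card_le_rel _ _ _ _ (fun x z =>
    (D x /\ z = p (x, d 0%N)) \/ (~ D x /\ z = p (k x, d 1%N)))).
    move=> x Ax; have [Dx|nDx] := pselect (D x).
      by exists (p (x, d 0%N)); [apply: pD; split=> //=; exact: dD|left].
    by exists (p (k x, d 1%N)); [apply: pD; split; [exact: kD|exact: dD]|right].
  have {}kD x : A x -> ~ D x -> D (k x) by move=> Ax nDx; exact: kD.
  move=> x y z Ax Ay [] [Dx ->] [] [Dy] /pinj2 e.
  - by have [] := e Dx (dD _) Dy (dD _).
  - by have [_ /dinj] := e Dx (dD _) (kD _ Ay Dy) (dD _).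
  - by have [_ /dinj] := e (kD _ Ax Dx) (dD _) Dy (dD _).
  - by have [/kinj ->] := e (kD _ Ax Dx) (dD _) (kD _ Ay Dy) (dD _).
(* [r] reads a point of [E] as a point of [D], and [t] records which copy of [D]
   it comes from. *)
pose E := D `|` k @` D.
have [r rP] : exists r : T -> T, forall x, D x -> r x = x /\ r (k x) = x.
  suff /choice[r rP] : forall x, exists y,
      (D x -> y = x) /\ (forall z, D z -> x = k z -> y = z).
    exists r => x Dx; have [-> // _] := rP x; split=> //.
    by have [_] := rP (k x); apply.
  move=> x; have [Dx|nDx] := pselect (D x).
    by exists x; split=> // z Dz e; have [_] := kD _ Dz; rewrite -e.
  have [[y Dy e]|ny] := pselect (exists2 y, D y & x = k y).
    exists y; split=> // z Dz e'; apply: kinj => //; exact: etrans (esym e) e'.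
  by exists x; split=> // z Dz e; case: ny; exists z.
pose t x := if pselect (D x) then d 0%N else d 1%N.
have tD x : D (t x) by rewrite /t; case: pselect => ?; exact: dD.
have rD x : E x -> D (r x).
  by move=> [Dx|[y Dy <-]]; [have [->] := rP x Dx|have [_ ->] := rP y Dy].
have rt x y : E x -> E y -> r x = r y -> t x = t y -> x = y.
  have tE z : D z -> t z = d 0%N by rewrite /t; case: pselect.
  have tN z : ~ D z -> t z = d 1%N by rewrite /t; case: pselect.
  move=> Ex Ey; have [Dx|nDx] := pselect (D x); have [Dy|nDy] := pselect (D y).
  - by have [-> _] := rP x Dx; have [-> _] := rP y Dy.
  - by rewrite tE// tN// => _ /dinj.
  - by rewrite tN// tE// => _ /dinj.
  - case: Ex nDx => // -[x' Dx' <-] _; case: Ey nDy => // -[y' Dy' <-] _.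
    by have [_ ->] := rP x' Dx'; have [_ ->] := rP y' Dy'; move=> ->.
pose c xy := k (p (p (r xy.1, r xy.2), p (t xy.1, t xy.2))).
have pDD x y : D x -> D y -> D (p (x, y)) by move=> Dx Dy; exact: pD.
have cD x y : E x -> E y -> D (p (p (r x, r y), p (t x, t y))).
  by move=> Ex Ey; apply: (pDD); apply: (pDD); try exact: rD; exact: tD.
pose G' := G `|` [set u | [/\ E u.1.1, E u.1.2, ~ (D u.1.1 /\ D u.1.2) &
                             u.2 = c u.1]].
have domG' : dom G' = E.
  apply/seteqP; split=> [x [z [Gz|[]//]]|x].
    by left; have [] := GD _ _ Gz.
  have [Dx _|nDx Ex] := pselect (D x).
    by have [z Gz] := totG _ _ Dx Dx; exists z; left.
  by exists (c (x, x)); right; split=> // -[].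
exfalso; apply: (Gmax G').
  split=> [|G'G]; first exact: subsetUl.
  have Ek : E (k (d 0%N)) by right; exists (d 0%N).
  have [_] := kD _ (dD 0%N); apply.
  rewrite -/D /D; exists (c (k (d 0%N), k (d 0%N))); apply: G'G; right.
  by split=> //= -[]; have [] := kD _ (dD 0%N).
split; rewrite ?domG'.
- by move=> _; apply: sub_infinite_set infD; exact: subsetUl.
- by move=> x [/DA//|[y Dy <-]]; have [] := kD _ Dy.
- move=> x y Ex Ey; have [[Dx Dy]|nD] := pselect (D x /\ D y).
    by have [z Gz] := totG _ _ Dx Dy; exists z; left.
  by exists (c (x, y)); right.
- move=> u z [Gz|[/= Ex Ey _ ->]].
    by have [? ? ?] := GD _ _ Gz; split; left.
  by split=> //; right; exists (p (p (r u.1, r u.2), p (t u.1, t u.2))) => //; exact: cD.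
- have GN u v : E v.1 -> E v.2 -> ~ G (u, c v).
    move=> Ev1 Ev2 /GD[_ _]; rewrite /c; set a := p _ => Dka.
    by have [] := kD a (cD _ _ Ev1 Ev2).
  move=> u v z [Gu|[/= Eu1 Eu2 _ zE]] [Gv|[/= Ev1 Ev2 _ zE']].
  + exact: Ginj Gu Gv.
  + by rewrite zE' in Gu; case: (GN _ _ Ev1 Ev2 Gu).
  + by rewrite zE in Gv; case: (GN _ _ Eu1 Eu2 Gv).
  + move: zE'; rewrite zE => /kinj => /(_ (cD _ _ Eu1 Eu2) (cD _ _ Ev1 Ev2)).
    move=> /pinj2 /(_ (pDD _ _ (rD _ Eu1) (rD _ Eu2)) (pDD _ _ (tD _) (tD _))
      (pDD _ _ (rD _ Ev1) (rD _ Ev2)) (pDD _ _ (tD _) (tD _)))[].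
    move=> /pinj2 /(_ (rD _ Eu1) (rD _ Eu2) (rD _ Ev1) (rD _ Ev2))[e1 e2].
    move=> /pinj2 /(_ (tD _) (tD _) (tD _) (tD _))[e3 e4].
    by rewrite [u]surjective_pairing [v]surjective_pairing (rt _ _ Eu1 Ev1 e1 e3)
      (rt _ _ Eu2 Ev2 e2 e4).
Qed.

(** The letters of a word are signed: [(b, inl t)] is the constant indexed by [t],
    [(b, inr n)] is the variable [x_n], and [b] asks for the inverse. The
    constants stay indices here, so that words can be counted and their constants
    replaced. *)
Fixpoint over T (A : set T) (u : seq (bool * (T + nat))) : Prop :=
  if u is l :: u' then (if l.2 is inl t then A t else True) /\ over A u' else True.

(** A pairing function on [A] codes letters, then words of a given length, by
    elements of [A]; the length is coded separately. *)
Lemma infinite_card_le_over T (A : set T) : infinite_set A -> over A #<= A.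
Proof.
elim/Ppointed: T => T in A *; first by rewrite emptyE => /(_ (finite_set0 _)).
move=> infA.
have [p [pA pinj]] := card_leP_ex (card_le_setX_self infA).
have {}pA x y : A x -> A y -> A (p (x, y)) by move=> Ax Ay; exact: pA.
have {}pinj x y x' y' : p (x, y) = p (x', y') ->
    A x -> A y -> A x' -> A y' -> x = x' /\ y = y'.
  move=> e Ax Ay Ax' Ay'.
  by have [] := pinj (x, y) (x', y') (conj Ax Ay) (conj Ax' Ay') e.
have [d [dA dinj]] : exists d : nat -> T, (forall i, A (d i)) /\ injective d.
  have /infiniteP/card_leP_ex[d [dA dinj]] := infA.
  by exists d; split=> [i|i j]; [exact: dA|exact: dinj].
pose c (l : bool * (T + nat)) := match l with
  | (b, inl t) => p (d b, t) | (b, inr n) => p (d b.+2, d n) end.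
pose ok (l : bool * (T + nat)) := if l.2 is inl t then A t else True.
have cA l : ok l -> A (c l).
  by case: l => b [t|n] /= okl; apply: pA.
have cinj l l' : ok l -> ok l' -> c l = c l' -> l = l'.
  case: l l' => [b [t|n]] [b' [t'|n']] /= okl okl' /pinj.
  - by move=> /(_ (dA _) okl (dA _) okl')[/dinj + ->]; case: (b) (b') => [] [].
  - by move=> /(_ (dA _) okl (dA _) (dA _))[/dinj]; case: (b) (b') => [] [].
  - by move=> /(_ (dA _) (dA _) (dA _) okl')[/dinj]; case: (b) (b') => [] [].
  - move=> /(_ (dA _) (dA _) (dA _) (dA _))[/dinj + /dinj <-].
    by case: (b) (b') => [] [].
pose f := foldr (fun l x => p (c l, x)) (d 0%N).
have fA u : over A u -> A (f u).
  elim: u => [_|l u IHu /= [okl /IHu Afu]]; first exact: dA.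
  exact: pA (cA _ okl) Afu.
have finj u v : over A u -> over A v -> size u = size v -> f u = f v -> u = v.
  elim: u v => [|l u IHu] [|l' v]//= [okl Au] [okl' Av] [uv].
  move=> /pinj.
  move=> /(_ (cA _ okl) (fA _ Au) (cA _ okl') (fA _ Av))[/cinj -> //].
  by move=> /IHu ->.
apply: (@card_le_rel _ _ _ _ (fun u x => x = p (d (size u), f u))) => [u Au|].
  by exists (p (d (size u), f u)) => //; apply: pA => //; exact: fA.
move=> u v _ Au Av -> /pinj/(_ (dA _) (fA _ Au) (dA _) (fA _ Av))[/dinj].
exact: finj.
Qed.

Lemma countable_over T (A : set T) : countable A -> countable (over A).
Proof.
move=> /countable_injP[f finj].
pose g (l : bool * (T + nat)) := match l with
  | (b, inl t) => (b, inl (f t)) | (b, inr n) => (b, inr n) end.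
pose S := seq (bool * (nat + nat)).
apply: (@card_le_trans _ _ _ [set: S]); last exact: countableP.
apply: (@card_le_rel _ _ _ [set: S] (fun u v => v = map g u)) => [u Au|u v w].
  by exists (map g u).
move=> + + ->; elim: u v => [|[b [t|n]] u IHu] [|[b' [t'|n']] v]//=.
  move=> [At Au] [At' Av] [-> /finj e /IHu ->]//.
  by rewrite e ?inE.
by move=> [_ Au] [_ Av] [-> -> /IHu ->].
Qed.

(** The words over [A] are at most as many as the elements of [A], or countably
    many: the passage from [A] to its words does not reach an uncountable cardinal. *)
Lemma card_le_over T U (X : set U) (A : set T) :
  ~ countable X -> X #<= over A -> X #<= A.
Proof.
move=> ncX XA.
have [/finite_set_countable/countable_over cA|infA] := pselect (finite_set A).
  by case: ncX; exact: card_le_trans XA cA.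
exact: card_le_trans XA (infinite_card_le_over infA).
Qed.

Lemma uncountable_cantor : ~ countable [set: cantor_space].
Proof.
move=> /pcard_surjP[g gsurj].
have [n _ gn] := gsurj (fun n => ~~ g n n) I.
by have := congr1 (fun x : cantor_space => x n) gn; case: (g n n).
Qed.

Lemma cantor_sequences : [set: nat -> nat -> bool] #<= [set: cantor_space].
Proof.
apply: (@card_le_rel _ _ _ _ (fun x y => forall i j, y (pickle (i, j)) = x i j)).
  move=> x _; exists (fun n => if unpickle n is Some (i, j) then x i j else false) => //.
  by move=> i j; rewrite pickleK.
by move=> x x' y _ _ xy x'y; apply/funext => i; apply/funext => j; rewrite -xy x'y.
Qed.

(** Cut a well-order of [T] at its first initial segment that is not smaller
    than [X]. *)
Lemma initial_well_order (T : eqType) U (X : set U) : X #<= [set: T] ->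
  exists (P : set T) (lt : T -> T -> Prop), [/\ well_founded lt,
    forall x y z, lt x y -> lt y z -> lt x z,
    forall x y, [\/ lt x y, x = y | lt y x],
    X #<= P & forall t, P t -> ~ (X #<= [set s | P s /\ lt s t])].
Proof.
move=> XT; have [R Rwo] := wochoice.well_ordering_principle T.
have Rch : wochoice.wo_chain R predT by move=> A _; exact: Rwo.
have Rtot x y : R x y || R y x by exact: (wochoice.wo_chainW Rch).
have Rrefl x : R x x by exact: (wochoice.wo_chain_reflexive Rch).
have Ranti x y : R x y -> R y x -> x = y.
  by move=> Rxy Ryx; apply: (wochoice.wo_chain_antisymmetric Rch) => //; rewrite Rxy.
have Rmin (A : set T) : A !=set0 -> exists2 z, A z & forall x, A x -> R z x.
  move=> [a Aa]; have [|z [[/asboolP Az minz] _]] := Rwo (fun x => `[< A x >]).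
    by exists a; exact/asboolP.
  by exists z => // x Ax; apply: minz; exact/asboolP.
have Rtrans x y z : R x y -> R y z -> R x z.
  move=> Rxy Ryz; have [|w wxyz minw] := Rmin [set x; y; z]; first by exists x; left; left.
  have Rwx := minw x (or_introl (or_introl erefl)).
  have Rwy := minw y (or_introl (or_intror erefl)).
  have Rwz := minw z (or_intror erefl).
  case: wxyz Rwx Rwy Rwz => [[|]|] -> Rwx Rwy Rwz //.
    by rewrite (Ranti _ _ Rxy Rwx).
  by rewrite -(Ranti _ _ Ryz Rwy).
pose lt x y := R x y /\ x <> y.
have wf : well_founded lt.
  move=> t; apply: contrapT => nAcc.
  have [|z nz minz] := Rmin [set t | ~ Acc lt t]; first by exists t.
  apply: nz; constructor => s [Rsz sz]; apply: contrapT => ns.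
  by apply: sz; apply: Ranti => //; exact: minz.
have trans x y z : lt x y -> lt y z -> lt x z.
  move=> [Rxy xy] [Ryz yz]; split; first exact: Rtrans Rxy Ryz.
  by move=> xz; rewrite -xz in Ryz; apply: xy; exact: Ranti.
have tri x y : [\/ lt x y, x = y | lt y x].
  have [->|/eqP xy] := eqVneq x y; first by constructor 2.
  have [Rxy|Ryx] := orP (Rtot x y); first by constructor 1.
  by constructor 3; split=> //; exact/nesym.
have [small|] := pselect (forall t, ~ (X #<= [set s | lt s t])).
  exists setT, lt; split=> // t _; apply: contra_not (small t).
  by move=> /card_le_trans; apply; apply: subset_card_le => s [].
move=> /existsNP[t0 /contrapT Xt0].
have [|t1 Xt1 mint1] := Rmin [set t | X #<= [set s | lt s t]]; first by exists t0.
exists [set s | lt s t1], lt; split=> // t [Rtt1 tt1] Xt.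
apply: tt1; apply: Ranti => //; apply: mint1 => /=.
by apply: card_le_trans Xt _; apply: subset_card_le => s [].
Qed.

(** * Clopen sets of compact spaces *)

Section quasicomponent.
Variable T : topologicalType.
Hypothesis cptT : compact [set: T].

Definition quasicomponent (x : T) : set T :=
  \bigcap_(C in [set C | C x /\ clopen C]) C.

(** Otherwise the traces on [~` W] of the clopen neighbourhoods of [x] would have a
    common point, by compactness. *)
Lemma quasicomponent_sub_open x (W : set T) : open W ->
  quasicomponent x `<=` W -> exists C, [/\ clopen C, C x & C `<=` W].
Proof.
move=> oW QW; pose F := filter_from [set D : set T | D x /\ clopen D] id.
have FF : Filter F.
  apply: filter_from_filter; first by exists setT; split => //; exact: clopenT.
  by move=> A B [? ?] [? ?]; exists (A `&` B) => //; split=> //; exact: clopenI.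
have PF : ProperFilter F by apply: filter_from_proper; move=> ? [? _]; exists x.
have /(iffLR (compact_near_coveringP _)) : compact (~` W).
  by apply: (subclosed_compact _ cptT) => //; exact: open_closedC.
move=> /(_ _ _ setC (powerset_filter_from_filter PF))[].
  move=> y nWy; have /existsNP[C /not_implyP[[Cx clC] nCy]] :
      ~ quasicomponent x y by move=> /QW.
  exists (~` C, [set U | U `<=` C]); first split.
  - by apply: open_nbhs_nbhs; split => //; apply: closed_openC; case: clC.
  - apply/near_powerset_filter_fromP; first by move=> ? ?; exact: subset_trans.
    by exists C => //; exists C.
  - by case=> i j [? /subsetC]; apply.
move=> D [DF _ [C DC]]/(_ _ DC)/subsetC2 CW.
by have [C' [C'x clC'] C'C] := DF _ DC; exists C'; split=> //; exact: subset_trans CW.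
Qed.

(** In a compact Hausdorff space, two disjoint closed parts of a quasicomponent
    have disjoint neighbourhoods [U] and [W], and some clopen neighbourhood [C] of
    [x] is covered by them; then [C `&` U] and [C `&` W] are clopen, so that the
    quasicomponent lies in one of them. *)
Lemma quasicomponent_connected x : hausdorff_space T ->
  connected (quasicomponent x).
Proof.
move=> hT B [b Bb] [V oV BV] [K cK BK].
set Q := quasicomponent x in BV BK *.
have cQ : closed Q by apply: closed_bigI => C [_ []].
have cB : closed B by rewrite BK; exact: closedI.
have cB' : closed (Q `\` B).
  rewrite BV setDIr setDv set0U; apply: closedI => //; exact: open_closedC.
apply/seteqP; split; first by rewrite BV => ? [].
apply: contrapT => /existsNP[z /not_implyP[Qz nBz]].
have [|N BN NB'] := @compact_normal _ hT cptT B cB (~` (Q `\` B)).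
  move=> y By; apply: open_nbhs_nbhs; split; first exact: closed_openC.
  by move=> [].
have [C [clC Cx CW]] : exists C, [/\ clopen C, C x & C `<=` N° `|` ~` closure N].
  apply: quasicomponent_sub_open.
    by apply: openU; [exact: open_interior|exact/closed_openC/closed_closure].
  move=> y Qy; have [By|nBy] := pselect (B y); first by left; exact: BN.
  by right; move=> /NB'; apply.
have NN y : N° y -> closure N y by move=> /interior_subset/subset_closure.
have clCN : clopen (C `&` N°).
  split; first by apply: openI; [case: clC|exact: open_interior].
  suff -> : C `&` N° = C `&` closure N.
    by apply: closedI; [case: clC|exact: closed_closure].
  by apply/seteqP; split=> y [Cy Ny]; split=> //; [exact: NN|case: (CW y Cy)].
have [Nx|nNx] := pselect (N° x).
  have /NB' : closure N z by apply: NN; have [] := Qz (C `&` N°) (conj (conj Cx Nx) clCN).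
  exact.
have Qb : Q b by move: Bb; rewrite BV => -[].
have [|_] := Qb (C `&` ~` (C `&` N°)).
- by split; [split=> // -[]|exact/clopenI/clopenC].
- by apply; split; [exact: Qb C (conj Cx clC)|exact: BN].
Qed.

(** A point that no clopen set separates from [x] lies in the quasicomponent of
    [x], hence in its component, which is [[set x]]. *)
Lemma totally_disconnected_zero_dimensional : hausdorff_space T ->
  totally_disconnected [set: T] -> zero_dimensional T.
Proof.
move=> hT tdT x y xy; apply: contrapT => /forallNP nC.
suff : connected_component [set: T] x y.
  by rewrite tdT// => /esym/eqP; exact/negP.
exists (quasicomponent x).
  by split=> //; [move=> C []|exact: quasicomponent_connected].
by move=> C [Cx clC]; apply: contrapT => nCy; exact: (nC C).
Qed.

End quasicomponent.

(** * Metrizable profinite spaces *)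

(** The uniformity of [d] is put on a copy of [T], over the given topology, so
    that results on pseudometric spaces speak about the topology of [T]. *)
Section metric_copy.
Context (R : realType) (T : ptopologicalType) (d : T -> T -> R).
Hypotheses (dxx : forall x, d x x = 0%R) (dC : forall x y, d x y = d y x)
  (dtri : forall x y z, (d x z <= d x y + d y z)%R)
  (dnbhs : forall x : T,
    nbhs x = nbhs_ball_ (fun y e => [set z | (d y z < e)%R]) x).

Definition metric_copy : Type :=
  let _ := dxx in let _ := dC in let _ := dtri in let _ := dnbhs in T.

HB.instance Definition _ := Pointed.on metric_copy.
HB.instance Definition _ := Topological.on metric_copy.

Let ball (x : metric_copy) e : set metric_copy := [set y | (d x y < e)%R].

Let ent : set_system (metric_copy * metric_copy) := entourage_ ball.

Let nbhsE : nbhs = nbhs_ ent.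
Proof.
apply/funext => x; rewrite dnbhs; apply/seteqP; split=> A.
  move=> [e e0 eA]; exists [set xy | ball xy.1 e xy.2]; first by exists e.
  by move=> y /xsectionP; exact: eA.
by move=> [B [e e0 eB] BA]; exists e => // y yx; apply: BA; apply/xsectionP; exact: eB.
Qed.

Let ball_center x (e : R) : (0 < e)%R -> ball x e x.
Proof. by rewrite /ball/= dxx. Qed.

Let ball_sym x y (e : R) : ball x e y -> ball y e x.
Proof. by rewrite /ball/= dC. Qed.

Let ball_triangle x y z e1 e2 : ball x e1 y -> ball y e2 z -> ball x (e1 + e2)%R z.
Proof. by rewrite /ball/= => ? ?; rewrite (le_lt_trans (dtri x y z))// ltrD. Qed.

HB.instance Definition _ := @Nbhs_isPseudoMetric.Build R metric_copy
  ent nbhsE ball ball_center ball_sym ball_triangle erefl.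
HB.instance Definition _ := Uniform_isPseudoMetric.Build R metric_copy
  ball_center ball_sym ball_triangle erefl.

End metric_copy.

Section profinite_space.
Context (R : realType) (T : ptopologicalType).
Hypotheses (T_metrizable : metrizable R T) (cptT : compact [set: T])
  (hT : hausdorff_space T) (tdT : totally_disconnected [set: T]).

Lemma clopen_enumeration : exists C : nat -> set T,
  (forall n, clopen (C n)) /\ forall D, clopen D -> exists n, C n = D.
Proof.
have [d [dxx _ dC dtri dnbhs]] := T_metrizable.
have [C] := @clopen_surj R (metric_copy dxx dC dtri dnbhs) cptT.
exists C; split=> [n|D clD]; first exact: (@funS _ _ _ _ C).
by have [n _ <-] := @surj _ _ _ _ C D clD; exists n.
Qed.

Lemma clopen_base (U : set T) x : open U -> U x ->
  exists D, [/\ clopen D, D x & D `<=` U].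
Proof.
move=> oU Ux; have zdT := totally_disconnected_zero_dimensional cptT hT tdT.
have [D [Dx clD] DU] := zero_dimensional_cvg hT zdT cptT (open_nbhs_nbhs (conj oU Ux)).
by exists D.
Qed.

(** Such a space is homeomorphic to the Cantor space. *)
Lemma perfect_card_ge_cantor : perfect_set [set: T] ->
  [set: cantor_space] #<= [set: T].
Proof.
move=> pT; have [d [dxx _ dC dtri dnbhs]] := T_metrizable.
have zdT := totally_disconnected_zero_dimensional cptT hT tdT.
have [//|f _] := @homeomorphism_cantor_like R (metric_copy dxx dC dtri dnbhs).
by apply/pcard_leP; squash f.
Qed.

End profinite_space.

(** * Borel probabilities on spaces with a countable clopen base *)

Local Open Scope ereal_scope.

Section finite_measure.
Context d (T : measurableType d) (R : realType) (P : probability T R).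

(** In a probability space, less than [n] disjoint sets have measure more than
    [1 / n]. *)
Lemma measurable_fibers_gt0_countable (Y : Type) (f : T -> Y) :
  (forall y, measurable (f @^-1` [set y])) ->
  countable [set y | 0 < P (f @^-1` [set y])].
Proof.
elim/Ppointed: Y => Y in f * => mf; first by rewrite emptyE_subdef.
pose p y := fine (P (f @^-1` [set y])).
have pE y : P (f @^-1` [set y]) = (p y)%:E by rewrite fineK// fin_num_measure.
rewrite [X in countable X](_ : _ = \bigcup_n [set y | n.+1%:R^-1 < p y]%R); last first.
  apply/seteqP; split=> y /=; rewrite pE lte_fin.
    by move=> /ltr_add_invr[k /[!add0r] kXr]; exists k.
  by move=> [k _]; exact: lt_trans.
apply: bigcup_countable => // n _; apply: finite_set_countable.
apply: contrapT => /infiniteP/pcard_leP/injfunPex[/= q q_fun q_inj].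
have /(probability_le1 P) : measurable (\bigcup_k f @^-1` [set q k]).
  exact: bigcup_measurable.
rewrite leNgt => /negP; apply.
rewrite [ltRHS](_ : _ = \sum_(0 <= k <oo) P (f @^-1` [set q k])); last first.
  rewrite measure_bigcup//; first by apply: eq_eseriesl =>// i; rewrite in_setT.
  rewrite (trivIset_comp (fun r => f @^-1` [set r]))//.
  exact: trivIset_preimage1.
apply: (lt_le_trans _ (nneseries_lim_ge n.+1 _)) => //.
under eq_bigr do rewrite pE.
rewrite sumEFin lte_fin (_ : 1%R = (\sum_(0 <= k < n.+1) n.+1%:R^-1:R)%R); last first.
  by rewrite sumr_const_nat subn0 -[RHS]mulr_natr mulVf.
by apply: ltr_sum => // k _; exact: q_fun.
Qed.

Lemma nonincreasing_measure_small (F : (set T)^nat) (e : R) : (0 < e)%R ->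
  (forall n, measurable (F n)) -> nonincreasing_seq F -> \bigcap_n F n = set0 ->
  exists N, P (F N) <= e%:E.
Proof.
move=> e0 mF niF F0; apply: contrapT => /forallNP eF.
have F0y : P (F 0%N) < +oo by rewrite (le_lt_trans (probability_le1 P (mF _)))// ltry.
have : P \o F @ \oo --> 0.
  by rewrite -(measure0 P) -F0; apply: nonincreasing_cvg_mu => //; rewrite F0.
move=> cvgF; have : e%:E <= 0.
  rewrite -(cvg_lim _ cvgF)//; apply: lime_ge; first by apply/cvg_ex; exists 0.
  by apply: nearW => n; apply: ltW; rewrite ltNge; exact/negP/eF.
by rewrite lee_fin leNgt e0.
Qed.

End finite_measure.

Lemma measurable_fun_borel d (X : measurableType d) (T : ptopologicalType)
    (f : X -> borel T) :
  (forall U : set T, open U -> measurable (f @^-1` U)) -> measurable_fun setT f.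
Proof.
move=> fU; apply: (@measurability _ _ X (borel T) setT f (@open T)) => //.
by move=> _ [U oU <-]; rewrite setTI; exact: fU.
Qed.

Section clopen_base.
Context (R : realType) (T : ptopologicalType) (C : nat -> set T).
Hypotheses (clC : forall n, clopen (C n))
  (baseC : forall U x, open U -> U x -> exists n, C n x /\ C n `<=` U).

Lemma open_bigcup_base U : open U -> U = \bigcup_(n in [set n | C n `<=` U]) C n.
Proof.
move=> oU; apply/seteqP; split=> [x Ux|x [n CU /CU]//].
by have [n [Cx CU]] := baseC oU Ux; exists n.
Qed.

Variable P : probability (borel T) R.

Lemma open_borel (U : set T) : open U -> measurable (U : set (borel T)).
Proof. exact: sub_sigma_algebra. Qed.

Lemma closed_borel (F : set T) : closed F -> measurable (F : set (borel T)).
Proof.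
by move=> cF; rewrite -[F]setCK; apply: measurableC; apply: open_borel; exact: closed_openC.
Qed.

Definition regular_set (B : set T) := forall e : R, (0 < e)%R ->
  exists F U : set T, [/\ closed F, open U, F `<=` B, B `<=` U & P (U `\` F) <= e%:E].

Lemma regular_clopen B : clopen B -> regular_set B.
Proof.
by move=> [oB cB] e e0; exists B, B; split=> //; rewrite setDv measure0 lee_fin ltW.
Qed.

(** The union of the inner approximations need not be closed, but finitely many of
    them already exhaust it up to [e / 2]. *)
Lemma regular_bigcup (B : nat -> set T) :
  (forall n, regular_set (B n)) -> regular_set (\bigcup_n B n).
Proof.
move=> rB e e0; have e2 : (0 < e / 2)%R by rewrite divr_gt0.
have en n : (0 < (e / 2) / (2 ^ n.+1)%:R)%R.
  by rewrite divr_gt0// ltr0n expn_gt0.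
have /choice[F] := fun n => rB n _ (en n).
move=> /choice[U FU].
have cF n : closed (F n) by have [] := FU n.
have oU n : open (U n) by have [] := FU n.
pose K N := \big[setU/set0]_(i < N) F i.
have cK N : closed (K N) by apply: closed_bigsetU.
have mF : measurable (\bigcup_n F n : set (borel T)).
  by apply: bigcup_measurable => n _; exact: closed_borel.
have mU : measurable (\bigcup_n U n : set (borel T)).
  by apply: bigcup_measurable => n _; exact: open_borel.
have mK N := closed_borel (cK N).
have [|||N KN] := @nonincreasing_measure_small _ _ _ P
    (fun N => \bigcup_n F n `\` K N) _ e2.
- by move=> N; exact: measurableD.
- apply/nonincreasing_seqP => N; apply/subsetPset; apply: setDS.
  by rewrite /K big_ord_recr/=; exact: subsetUl.
- apply/seteqP; split=> // x Fx; have [[n _ Fnx] _] := Fx 0%N I.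
  by have [_] := Fx n.+1 I; apply; rewrite /K big_ord_recr; right.
exists (K N), (\bigcup_n U n); split=> //.
- exact: bigcup_open.
- move=> x; rewrite /K -bigcup_mkord => -[n _ Fx]; exists n => //.
  by have [_ _ + _ _] := FU n; apply.
- by move=> x [n _ Bx]; exists n => //; have [_ _ _ + _] := FU n; apply.
apply: (@le_trans _ _ (P ((\bigcup_n U n `\` \bigcup_n F n) `|` (\bigcup_n F n `\` K N)))).
  apply: le_measure; rewrite ?inE; try by do ?[exact: measurableD|apply: measurableU].
  move=> x [Ux nKx]; have [Fx|nFx] := pselect ((\bigcup_n F n) x); first by right.
  by left.
apply: (le_trans (measureU2 _ _ _)); try exact: measurableD.
rewrite [leRHS](_ : _ = (e / 2)%:E + (e / 2)%:E); last by rewrite -EFinD -splitr.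
apply: leeD => //; apply: (le_trans _ (@epsilon_trick0 _ _ xpredT (ltW e2))).
apply: (@le_trans _ _ (\sum_(n <oo) P (U n `\` F n))).
  apply: measure_sigma_subadditive; [|exact: measurableD|].
    by move=> n; apply: measurableD; [exact: open_borel|exact: closed_borel].
  by move=> x [[n _ Ux] nFx]; exists n => //; split=> // Fx; apply: nFx; exists n.
by apply: lee_nneseries => // n _; have [] := FU n.
Qed.

(** The regular sets form a sigma-algebra; it contains the clopen sets, and every
    open set is a countable union of these. *)
Lemma borel_regular (B : set (borel T)) : measurable B -> regular_set B.
Proof.
suff : <<s @open T >> `<=` regular_set by apply.
apply: smallest_sub; last first.
  move=> U oU; rewrite (open_bigcup_base oU) bigcup_mkcond.
  apply: regular_bigcup => n; apply: regular_clopen.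
  by case: ifP => // _; exact: clopen0.
split; first exact/regular_clopen/clopen0.
- move=> A rA e e0; have [F [U [cF oU FA AU UF]]] := rA e e0.
  exists (~` U), (~` F); split.
  + exact: open_closedC.
  + exact: closed_openC.
  + by rewrite setTD; exact: subsetC.
  + by rewrite setTD; exact: subsetC.
  + by rewrite setDE setCK setIC -setDE.
- exact: regular_bigcup.
Qed.

End clopen_base.

(** * Haar measure *)

Section topological_group.
Variable G : topologicalGroupType.

Lemma lmulg_continuous (g : G) : continuous (fun x => g * x)%g.
Proof.
move=> x; apply: (@continuous_comp _ _ _ (fun x => (g, x)) (fun x : G * G => x.1 * x.2)%g).
  by apply: cvg_pair => //=; exact: cvg_cst.
exact: mulg_continuous.
Qed.

Lemma image_lmulg (g : G) (A : set G) :
  [set (g * a)%g | a in A] = (fun x => (g^-1 * x)%g) @^-1` A.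
Proof.
apply/seteqP; split=> [_ [a Aa <-]|x Ax]/=; first by rewrite mulKg.
by exists (g^-1 * x)%g => //; rewrite mulVKg.
Qed.

Lemma open_image_lmulg (g : G) (U : set G) : open U -> open [set (g * a)%g | a in U].
Proof.
move=> oU; rewrite image_lmulg; apply: open_comp => // x _.
exact: lmulg_continuous.
Qed.

Lemma measurable_image_lmulg (g : G) (A : set (borel G)) :
  measurable A -> measurable ([set (g * a)%g | a in A] : set (borel G)).
Proof.
rewrite image_lmulg => mA; rewrite -[X in measurable X]setTI.
apply: (@measurable_fun_borel _ (borel G)) mA => // U oU; apply: open_borel.
by apply: open_comp => // x _; exact: lmulg_continuous.
Qed.

(** An isolated point makes the group discrete, hence finite by compactness. *)
Lemma infinite_compact_group_perfect : infinite_set [set: G] -> compact [set: G] ->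
  perfect_set [set: G].
Proof.
move=> infG; rewrite compact_cover => cptG; apply/perfectTP => x ox; apply: infG.
have os (y : G) : open [set y].
  suff -> : [set y] = [set (y * x^-1 * a)%g | a in [set x]] by exact: open_image_lmulg.
  by rewrite image_set1 mulgVK.
have [|D' _ D'G] := cptG G setT (fun y => [set y]) (fun y _ => os y).
  by move=> y _; exists y.
apply: (sub_finite_set _ (finite_fset D')) => y /D'G [z zD ->] //.
Qed.

End topological_group.

(** The numerical contradiction in Steinhaus's theorem: [f], [u] and [b] stand for
    [mu F], [mu U] and [mu B], and two disjoint sets of measure [f] do not fit in [U]. *)
Lemma majority_overlap (R : realFieldType) (f u b : R) : (0 < b / 3 ->
  u <= f + b / 3 -> b <= f + b / 3 -> f + f <= u -> False)%R.
Proof. lra. Qed.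

Section haar_measure.
Context (R : realType) (G : topologicalGroupType) (mu : probability (borel G) R).
Hypotheses (G_infinite : infinite_set [set: G]) (G_metrizable : metrizable R G)
  (G_profinite : profinite G) (mu_haar : is_haar mu).

Lemma profinite_clopen_base : exists C : nat -> set G, (forall n, clopen (C n)) /\
  forall U x, open U -> U x -> exists n, C n x /\ C n `<=` U.
Proof.
have [cptG hG tdG] := G_profinite.
have [C [clC surjC]] := clopen_enumeration G_metrizable cptG.
exists C; split=> // U x oU Ux.
have [D [clD Dx DU]] := clopen_base cptG hG tdG oU Ux.
by have [n nD] := surjC _ clD; exists n; rewrite nD.
Qed.

Lemma card_ge_cantor_group : [set: cantor_space] #<= [set: G].
Proof.
have [cptG hG tdG] := G_profinite.
exact: (perfect_card_ge_cantor G_metrizable cptG hG tdG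
  (infinite_compact_group_perfect G_infinite cptG)).
Qed.

Lemma closed_set1_group (x : G) : closed [set x].
Proof.
have [_ hG _] := G_profinite.
exact: accessible_closed_set1 (hausdorff_accessible hG) x.
Qed.

(** All points have the same measure; if it is positive, the group is countable. *)
Lemma haar_set1 (x : G) : mu [set x] = 0.
Proof.
have m1 (y : G) : measurable ([set y] : set (borel G)).
  exact: (@closed_borel G _ (@closed_set1_group _)).
have mu1 (y : G) : mu [set y] = mu [set x].
  rewrite -(mu_haar (y * x^-1)%g (m1 x)); congr (mu _).
  by rewrite image_set1 mulgVK.
apply/eqP; rewrite -measure_le0 leNgt; apply/negP => x0.
have cG := measurable_fibers_gt0_countable mu (f := id) m1.
apply/uncountable_cantor/(card_le_trans card_ge_cantor_group)/(card_le_trans _ cG).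
by apply: subset_card_le => y _ /=; rewrite -[X in 0 < X]/(mu [set y]) mu1.
Qed.

Lemma haar_countable (A : set G) : countable A -> mu.-negligible A.
Proof.
move=> /pcard_surjP[g gA]; apply: (@negligibleS _ (borel G) _ mu (\bigcup_n [set g n])).
  by move=> x /gA[n _ <-]; exists n.
apply: negligible_bigcup => n; apply/negligibleP; last exact: haar_set1.
exact: (@closed_borel G _ (@closed_set1_group _)).
Qed.

(** Finitely many translates of [U] cover the group. *)
Lemma haar_open_gt0 (U : set G) : open U -> U !=set0 -> 0 < mu U.
Proof.
move=> oU [x Ux]; rewrite lt_neqAle measure_ge0 andbT; apply/negP => /eqP mU0.
have [+ _ _] := G_profinite; rewrite compact_cover.
move=> /(_ G setT (fun y => [set (y * x^-1 * a)%g | a in U])) [||D' _ D'G].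
- by move=> y _; exact: open_image_lmulg.
- by move=> y _; exists y => //; exists x => //; rewrite mulgVK.
pose V (y : G) : set (borel G) := [set (y * x^-1 * a)%g | a in U].
have : mu setT <= \sum_(y \in [set` D']) mu (V y).
  apply: content_sub_fsum => //.
  by move=> y _; exact: measurable_image_lmulg (open_borel oU).
rewrite probability_setT fsbig1 ?leNgt ?lte01// => y _.
by rewrite [RHS]mU0; apply: mu_haar; exact: open_borel.
Qed.

(** Steinhaus: take [F `<=` B `<=` U] with [F] compact, [U] open and [mu F] more than
    half of [mu U]. All [v] close to [1] satisfy [v F `<=` U], so that [v F] meets
    [F]. *)
Lemma steinhaus (B : set (borel G)) : measurable B -> 0 < mu B ->
  exists V : set G, [/\ open V, V 1%g &
    forall v, V v -> exists b c, [/\ B b, B c & (v * c)%g = b]].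
Proof.
move=> mB B0; have [C [clC baseC]] := profinite_clopen_base.
have muE (A : set (borel G)) : measurable A -> mu A = (fine (mu A))%:E.
  by move=> mA; rewrite fineK// fin_num_measure.
have e0 : (0 < fine (mu B) / 3)%R by rewrite divr_gt0// -lte_fin -muE.
have [F [U [cF oU FB BU UF]]] := borel_regular clC baseC mu mB e0.
have mF := closed_borel cF; have mU := open_borel oU.
have [cptG _ _] := G_profinite.
have cptF : compact F by apply: (subclosed_compact _ cptG).
have [V' nV' FV'] : exists2 V', nbhs (1%g : G) V' &
    forall v, V' v -> F `<=` [set x | U (v * x)%g].
  exists [set v | F `<=` [set x | U (v * x)%g]] => //.
  move/compact_near_coveringP : cptF => /(_ _ (nbhs (1%g : G)) (fun v x => U (v * x)%g)).
  apply=> x Fx.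
  have : nbhs (1%g, x) ((fun p : G * G => (p.1 * p.2)%g) @^-1` U).
    apply: mulg_continuous; apply: open_nbhs_nbhs; split=> //=.
    by rewrite mul1g; apply/BU/FB.
  move=> [[W W'] /= [nW nW'] WU]; exists (W', W); [exact: conj|move=> [y v] /= [W'y Wv]].
  exact: (WU (v, y)).
exists V'°; split; first exact: open_interior.
  exact: nbhs_singleton (nbhs_interior nV').
move=> v /interior_subset V'v.
suff [b [[c Fc cb] Fb]] : [set (v * a)%g | a in F] `&` F !=set0.
  by exists b, c; split=> //; exact: FB.
apply/set0P/negP => /eqP vF0.
pose vF : set (borel G) := [set (v * a)%g | a in F].
have mvF : measurable vF := measurable_image_lmulg v mF.
have : mu F + mu F <= mu U.
  have muvF : mu vF = mu F by exact: mu_haar.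
  rewrite -{1}muvF -measureU//.
  apply: le_measure; [exact/mem_set/measurableU|exact/mem_set|].
  by move=> _ [[a Fa <-]|/FB/BU//]; exact: FV'.
have mUF : measurable (U `\` F : set (borel G)) by exact: measurableD.
have : mu B <= mu F + (fine (mu B) / 3)%:E.
  apply: le_trans (leeD2l _ UF); apply: le_trans (measureU2 _ mF mUF).
  apply: le_measure; [exact/mem_set|exact/mem_set/measurableU|].
  by move=> x /BU Ux; have [|] := pselect (F x); [left|right].
have : mu U <= mu F + (fine (mu B) / 3)%:E.
  apply: le_trans (leeD2l _ UF); apply: le_trans (measureU2 _ mF mUF).
  apply: le_measure; [exact/mem_set|exact/mem_set/measurableU|].
  by move=> x Ux; have [|] := pselect (F x); [left|right].
rewrite (muE _ mF) (muE _ mU) (muE _ mB).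
by rewrite -!EFinD !lee_fin; exact: majority_overlap.
Qed.

(** Steinhaus's theorem gives quotients [b / c] of elements of the subgroup. *)
Lemma haar_measurable_subgroup (H : set G) : group_closed (mem H) ->
  is_haar_measurable mu H -> ~ mu.-negligible H ->
  exists V : set G, [/\ open V, V 1%g & V `<=` H].
Proof.
move=> gH [B mB [N negN BNH]] nH.
have [|V [oV V1 VB]] := steinhaus mB.
  rewrite lt_neqAle measure_ge0 andbT; apply/negP => /eqP B0; apply: nH.
  by rewrite -BNH; apply: negligibleU negN; apply/negligibleP.
exists V; split=> // v /VB[b [c [Bb Bc vcb]]].
have BH x : B x -> x \in mem H by move=> Bx; apply/mem_set; rewrite -BNH; left.
suff /set_mem : v \in mem H by [].
by rewrite -(mulgK c v) vcb; apply: gH.2; exact: BH.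
Qed.

End haar_measure.

(** * Transporting the coin-tossing measure *)

Section coin.
Context (R : realType) (lambda : probability (borel cantor_space) R).
Hypothesis lambda_coin : is_coin_measure lambda.

Definition cyl (s : seq bool) : set cantor_space :=
  [set x | forall i, (i < size s)%N -> x i = nth false s i].

Lemma coin_cyl s : lambda (cyl s) = ((2^-1) ^+ size s)%:E%R.
Proof.
rewrite -(lambda_coin (in_tuple s)); congr (lambda _).
apply/seteqP; split=> x sx.
  by move=> i; rewrite (tnth_nth false)/=; exact: sx.
by move=> i si; have := sx (Ordinal si); rewrite (tnth_nth false).
Qed.

Lemma measurable_coord i b :
  measurable ([set x : cantor_space | x i = b] : set (borel cantor_space)).
Proof.
apply: open_borel; suff : @open cantor_space (proj i @^-1` [set b]) by [].
apply: open_comp; [move=> + _; exact: proj_continuous|exact: discrete_open].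
Qed.

Lemma cyl_rcons s b : cyl (rcons s b) = cyl s `&` [set x | x (size s) = b].
Proof.
apply/seteqP; split=> [x sx|x [sx xb] i].
  split=> [i si|]; last first.
    by rewrite /= sx ?size_rcons// nth_rcons ltnn eqxx.
  by rewrite sx ?size_rcons ?(leqW si)// nth_rcons si.
rewrite size_rcons ltnS leq_eqVlt nth_rcons => /orP[/eqP ->|si].
  by rewrite ltnn eqxx.
by rewrite si; exact: sx.
Qed.

Lemma measurable_cyl s : measurable (cyl s : set (borel cantor_space)).
Proof.
elim/last_ind: s => [|s b IHs].
  by rewrite (_ : cyl [::] = setT)//; apply/seteqP; split.
by rewrite cyl_rcons; apply: measurableI => //; exact: measurable_coord.
Qed.

(** [below n y c] says that all reals of the dyadic interval of level [n] whose
    first binary digits are those of [y] are below [c], with room: with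
    [0.y_0 ... y_(n-1)] in base 2 it means [0.y_0 ... y_(n-1) + 2^-n < c]. *)
Fixpoint below n (y : nat -> bool) (c : R) : bool :=
  if n is n'.+1 then below n' (fun k => y k.+1) (if y 0%N then 2 * c - 1 else 2 * c)%R
  else (1 < c)%R.

Lemma below_gt1 n y c : (1 < c)%R -> below n y c.
Proof. by elim: n y c => //= n IHn y c c1; apply: IHn; case: (y _); lra. Qed.

Lemma below_le n y c c' : (c <= c')%R -> below n y c -> below n y c'.
Proof.
elim: n y c c' => [|n IHn] y c c' cc' /=; first by move=> /lt_le_trans; apply.
by apply: IHn; case: (y _); lra.
Qed.

Lemma belowS n y c : below n y c -> below n.+1 y c.
Proof.
elim: n y c => [|n IHn] y c; first by rewrite /=; case: (y _); lra.
by move=> /IHn.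
Qed.

Lemma below_gt0 n y c : below n y c -> (0 < c)%R.
Proof.
elim: n y c => [|n IHn] y c /=; first by lra.
by move=> /IHn; case: (y _); lra.
Qed.

Definition below_set (c : R) : set cantor_space := [set x | exists n, below n x c].

(* The sequences that start with [s] and whose remaining digits, read as a new
   expansion, are [below] at level [n]. *)
Let slice s n c := cyl s `&` [set x | below n (fun k => x (size s + k)%N) c].

Let sliceS s n c : slice s n.+1 c =
  slice (rcons s true) n (2 * c - 1)%R `|` slice (rcons s false) n (2 * c)%R.
Proof.
rewrite /slice !cyl_rcons !size_rcons.
have shift (x : cantor_space) : (fun k => x (size s + k.+1)%N) =
      (fun k => x ((size s).+1 + k)%N).
  by apply/funext => k; rewrite addSnnS.
apply/seteqP; split=> x /=.
  rewrite shift addn0; case: ifP => xs [sx xc]; [left|right]; split=> //; split=> //.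
by case=> -[[sx xs] xc]; split=> //; rewrite shift addn0 xs.
Qed.

Let measurable_slice s n c : measurable (slice s n c : set (borel cantor_space)).
Proof.
elim: n s c => [|n IHn] s c; last by rewrite sliceS; exact: measurableU.
apply: measurableI; first exact: measurable_cyl.
rewrite /below; case: (ltP 1%R c) => _.
  by rewrite (_ : [set _ | _] = setT)//; apply/seteqP; split.
by rewrite (_ : [set _ | _] = set0)//; apply/seteqP; split.
Qed.

Let clamp (c : R) : R := Num.max 0%R (Num.min 1%R c).

(* By induction on [n], splitting along the next digit. If [c <= 1 / 2], the digit
   [true] contributes nothing; otherwise the digit [false] contributes the whole
   cylinder. In both cases only one half carries an error. *)
Let coin_slice s n c : exists2 r : R, lambda (slice s n c) = r%:E &
  ((2^-1) ^+ size s * (clamp c - (2^-1) ^+ n) <= r <= (2^-1) ^+ size s * clamp c)%R.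
Proof.
elim: n s c => [|n IHn] s c.
  have p0 : (0 <= (2^-1 : R) ^+ size s)%R by rewrite exprn_ge0.
  rewrite /slice /= expr0 /clamp; case: (boolP (1 < c)%R) => c1.
    exists ((2^-1) ^+ size s)%R; last by rewrite min_l ?(ltW c1)// max_r//; nra.
    rewrite (_ : _ `&` _ = cyl s) ?coin_cyl//.
    by apply/seteqP; split=> [x []|].
  rewrite -leNgt in c1; exists 0%R; last first.
    rewrite min_r// mulr_ge0 ?le_max ?lexx// andbT mulr_ge0_le0// subr_le0.
    by rewrite ge_max ler01.
  by rewrite (_ : _ `&` _ = set0) ?measure0//; apply/seteqP; split=> [x []|].
have [r1 r1E /andP[r1l r1u]] := IHn (rcons s true) (2 * c - 1)%R.
have [r2 r2E /andP[r2l r2u]] := IHn (rcons s false) (2 * c)%R.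
exists (r1 + r2)%R.
  rewrite sliceS measureU//= ?r1E ?r2E//.
  apply/seteqP; split=> // x [[+ _] [+ _]].
  by rewrite !cyl_rcons => -[_ /= ->] [].
move: r1l r1u r2l r2u; rewrite !size_rcons !exprS.
set p := ((2^-1 : R) ^+ size s)%R; set q := ((2^-1 : R) ^+ n)%R.
have p0 : (0 <= p)%R by rewrite exprn_ge0.
have q0 : (0 <= q)%R by rewrite exprn_ge0.
have r10 : (0 <= r1)%R by rewrite -lee_fin -r1E.
have [c1|c1] := leP (2 * c)%R 1%R.
  have -> : clamp (2 * c - 1) = 0%R by rewrite /clamp min_r ?max_l//; lra.
  have -> : clamp (2 * c) = (2 * clamp c)%R.
    by rewrite /clamp !min_r ?maxr_pMr ?mulr0//; lra.
  by move=> *; apply/andP; split; nra.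
have -> : clamp (2 * c) = 1%R by rewrite /clamp min_l ?max_r//; lra.
have r2E' : r2 = (p / 2)%R.
  apply/EFin_inj; rewrite -r2E /slice (_ : _ `&` _ = cyl (rcons s false)).
    by rewrite coin_cyl size_rcons exprSr.
  by apply/seteqP; split=> [x []//|x sx]; split=> //=; exact: below_gt1.
have -> : clamp (2 * c - 1) = (2 * clamp c - 1)%R.
  rewrite /clamp; case: (leP 1%R c) => c2.
    by rewrite !min_l ?max_r//; lra.
  by rewrite !min_r ?max_r//; lra.
rewrite r2E'; move=> *; apply/andP; split; nra.
Qed.

Lemma measurable_below_set c : measurable (below_set c : set (borel cantor_space)).
Proof.
rewrite (_ : below_set c = \bigcup_n slice [::] n c); last first.
  by apply/seteqP; split=> [x [n xn]|x [n _ [_ xn]]]; exists n.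
exact: bigcup_measurable.
Qed.

(** The number with a coin-tossing sequence as its binary expansion is uniformly
    distributed: at level [n], [below] detects the numbers less than [c] up to an
    error of [2^-n]. *)
Lemma coin_below_set c : (0 <= c <= 1)%R -> lambda (below_set c) = c%:E.
Proof.
move=> /andP[c0 c1].
have sE : below_set c = \bigcup_n slice [::] n c.
  by apply/seteqP; split=> [x [n xn]|x [n _ [_ xn]]]; exists n.
have cc : clamp c = c by rewrite /clamp min_r// max_r.
have mono : nondecreasing_seq (fun n => slice [::] n c).
  by apply/nondecreasing_seqP => n; apply/subsetPset => x [sx /belowS].
have /cvg_lim := nondecreasing_cvg_mu (mu := lambda) (fun n => measurable_slice [::] n c)
  (bigcup_measurable (fun n _ => measurable_slice [::] n c)) mono.
rewrite sE => <- //; apply/cvg_lim => //.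
have /choice[r rE] : forall n, exists r : R, lambda (slice [::] n c) = r%:E /\
    (c - 2^-1 ^+ n <= r <= c)%R.
  move=> n; have [r rE] := coin_slice [::] n c.
  by rewrite expr0 !mul1r cc; exists r.
rewrite (_ : lambda \o _ = EFin \o r); last by apply/funext => n /=; have [] := rE n.
apply: cvg_EFin; first by apply: nearW.
apply: (@squeeze_cvgr _ _ _ _ (fun n => c - 2^-1 ^+ n)%R (cst c)).
- by apply: nearW => n; have [] := rE n.
- rewrite -[X in _ --> X]subr0; apply: cvgB; first exact: cvg_cst.
  by apply: cvg_expr; rewrite ger0_norm; lra.
- exact: cvg_cst.
Qed.

End coin.

Lemma probability_setI_full d (T : measurableType d) (R : realType)
    (P : probability T R) (E A : set T) :
  measurable E -> measurable A -> P E = 1 -> P A = P (A `&` E).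
Proof.
move=> mE mA E1; rewrite (measureDI P mA mE) -[RHS]add0e; congr (_ + _).
apply/eqP; rewrite -measure_le0; apply: (@le_trans _ _ (P (~` E))).
  apply: le_measure => [||x []//]; apply/mem_set.
    exact: measurableD.
  exact: measurableC.
by rewrite probability_setC// E1 subee.
Qed.

Section transport.
Context (R : realType) (lambda : probability (borel cantor_space) R)
  (T : ptopologicalType) (C : nat -> set T) (P : probability (borel T) R).
Hypotheses (lambda_coin : is_coin_measure lambda) (cptT : compact [set: T])
  (clC : forall n, clopen (C n))
  (baseC : forall U x, open U -> U x -> exists n, C n x /\ C n `<=` U).

(** The nonempty cells of level [n] are the atoms of the algebra generated by
    [C 0, ..., C (n - 1)]; the first bit of a code is the last one chosen. *)
Fixpoint cell (s : seq bool) : set T :=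
  if s is b :: s' then cell s' `&` (if b then C (size s') else ~` C (size s'))
  else setT.

Lemma clopen_cell s : clopen (cell s).
Proof.
elim: s => [|b s IHs] /=; first exact: clopenT.
apply: clopenI IHs _; case: b; [exact: clC|exact: (@clopenC _ _ set0 (clC _))].
Qed.

Lemma measurable_cell s : measurable (cell s : set (borel T)).
Proof. by apply: open_borel; case: (clopen_cell s). Qed.

Lemma cell_inj s s' y : size s = size s' -> cell s y -> cell s' y -> s = s'.
Proof.
elim: s s' => [|b s IHs] [|b' s']//= [ss'] [sy by_] [s'y b'y].
rewrite (IHs s')//; congr cons; move: by_ b'y; rewrite ss'.
by case: b b' => -[].
Qed.

Lemma cell_drop k s : cell s `<=` cell (drop k s).
Proof.
elim: k s => [|k IHk] [|b s]//=; rewrite ?drop0//.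
by move=> y [/IHk].
Qed.

Lemma cell_setI_closed : setI_closed [set B | B = set0 \/ exists s, B = cell s].
Proof.
have le_size s s' : (size s <= size s')%N ->
    cell s `&` cell s' = set0 \/ cell s `&` cell s' = cell s'.
  move=> ss'; have [->|/set0P[y [sy s'y]]] := eqVneq (cell s `&` cell s') set0.
    by left.
  right; have -> : s = drop (size s' - size s) s'.
    apply: (cell_inj _ sy (@cell_drop _ _ _ s'y)).
    by rewrite size_drop subKn.
  by rewrite setIidr//; exact: cell_drop.
move=> A B [->|[s ->]] [->|[s' ->]]; rewrite ?set0I ?setI0; try by left.
have [/le_size[]|/ltnW/le_size[]] := leqP (size s) (size s').
- by left.
- by right; exists s'.
- by rewrite setIC; left.
- by rewrite setIC; right; exists s.
Qed.

Lemma cell_base U y : open U -> U y -> exists s, cell s y /\ cell s `<=` U.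
Proof.
move=> oU Uy; have [n [Cy CU]] := baseC oU Uy.
have [s [sn sy]] : exists s, size s = n /\ cell s y.
  elim: (n) => [|m [s [sm sy]]]; first by exists [::].
  exists (`[< C m y >] :: s); split; rewrite /= ?sm//; split=> //.
  by case: asboolP.
by exists (true :: s); rewrite /= sn; split=> // z [_ /CU].
Qed.

Let w s : R := fine (P (cell s)).

Let PE s : P (cell s) = (w s)%:E.
Proof. by rewrite fineK// fin_num_measure//; exact: measurable_cell. Qed.

Let w_ge0 s : (0 <= w s)%R. Proof. exact: fine_ge0. Qed.

Let w_split s : (w s = w (false :: s) + w (true :: s))%R.
Proof.
apply: EFin_inj; rewrite EFinD -!PE -measureU; last first.
  by apply/seteqP; split=> // y /= [[_ nCy] [_ Cy]].
- exact: measurable_cell.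
- exact: measurable_cell.
congr (P _); apply/seteqP; split=> [y sy|y /= [[]|[]]//].
by have [Cy|nCy] := pselect (C (size s) y); [right|left].
Qed.

(* The cells of a given level, read from left to right, cut [[0, 1]] into intervals
   of lengths [w s]; [a s] is the left end of the interval of [s]. *)
Let Fixpoint a s : R :=
  if s is b :: s' then (if b then a s' + w (false :: s') else a s')%R else 0%R.

Let a_bounds s : (0 <= a s)%R /\ (a s + w s <= 1)%R.
Proof.
elim: s => [|b s [a0 a1]].
  split=> //; rewrite [a [::]]/(0%R) add0r -lee_fin -PE.
  apply: probability_le1; exact: measurable_cell.
have := w_split s; have := w_ge0 (false :: s); have := w_ge0 (true :: s).
by case: b => /=; lra.
Qed.

Let L c := below_set (c : R).

Let L_le c c' : (c <= c')%R -> L c `<=` L c'.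
Proof. by move=> cc' x [n xn]; exists n; exact: below_le xn. Qed.

Let L0 : L 0%R = set0.
Proof. by apply/seteqP; split=> // x [n /below_gt0]; rewrite ltxx. Qed.

(* The codes of the intervals that contain the number with binary expansion [x]. *)
Let Fixpoint path (x : cantor_space) n : seq bool :=
  if n is n'.+1 then let s := path x n' in `[< ~ L (a (true :: s)) x >] :: s else [::].

Let size_path x n : size (path x n) = n.
Proof. by elim: n => //= n ->. Qed.

Let pathE s : [set x | path x (size s) = s /\ L 1%R x] = L (a s + w s)%R `\` L (a s).
Proof.
elim: s => [|b s IHs].
  rewrite [a [::]]/(0%R) add0r L0 setD0.
  have -> : w [::] = 1%R by apply: EFin_inj; rewrite -PE probability_setT.
  by apply/seteqP; split=> [x []|].
have -> : [set x | path x (size (b :: s)) = b :: s /\ L 1%R x] =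
    (L (a s + w s)%R `\` L (a s)) `&` [set x | `[< ~ L (a (true :: s)) x >] = b].
  rewrite -IHs; apply/seteqP; split=> x /=.
    by move=> [[<- ps] x1]; rewrite ps.
  by move=> [[ps x1] <-]; rewrite ps.
have := w_split s; have := w_ge0 (false :: s); have := w_ge0 (true :: s) => w1 w2 wE.
case: b => /=; apply/seteqP; split=> x /=.
- by move=> [[xaw _] /asboolP xa]; split=> //; apply: L_le xaw; lra.
- move=> [xaw nxa]; split; last exact/asboolP.
  by split; [apply: L_le xaw|apply: contra_not nxa; apply: L_le]; lra.
- by move=> [[xaw nxa] /asboolPn/contrapT xa]; split.
- move=> [xaw nxa]; split; last by apply/asboolPn => /(_ xaw).
  by split=> //; apply: L_le xaw; lra.
Qed.

(* The intervals along the path have positive length, so that the cells are not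
   empty, and they shrink to a point by compactness. *)
Let cell_path_point x : L 1%R x -> exists y, forall n, cell (path x n) y.
Proof.
move=> x1.
pose F := filter_from [set: nat] (fun n => cell (path x n)).
have mono m n : (m <= n)%N -> cell (path x n) `<=` cell (path x m).
  move=> /subnK <-; elim: (n - m)%N => //= k IHk y [+ _]; exact: IHk.
have PF : ProperFilter F.
  apply: filter_from_proper; first apply: filter_from_filter; first by exists 0%N.
    move=> m n _ _; exists (maxn m n) => // y xy.
    by split; apply: mono xy; rewrite ?leq_maxl ?leq_maxr.
  move=> n _; apply: contrapT => /set0P/negP/negPn/eqP n0.
  have : [set z | path z (size (path x n)) = path x n /\ L 1%R z] x.
    by rewrite /= size_path.
  rewrite pathE => -[xaw nxa]; apply: nxa; move: xaw.
  by rewrite /w n0 measure0 addr0.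
have [|y [_ Fy]] := cptT PF; first exact: filterT.
exists y => n; have [_ cl] := clopen_cell (path x n).
have /closure_id -> := cl; move: Fy; rewrite clusterE; apply.
by exists n.
Qed.

(** The map [f] sends a sequence, read as a number in [[0, 1]], to a point in all the
    cells whose intervals contain this number. The preimage of a cell is then its
    interval, up to a null set, so that [f] sends the coin-tossing measure to [P]:
    both measures agree on the cells, which form a generating pi-system. Hence the
    preimages of null sets are null. *)
Lemma coin_transport : exists f : cantor_space -> T,
  forall X, ~ lambda.-negligible X -> ~ P.-negligible (f @` X).
Proof.
have /choice[f fP] : forall x, exists y, (L 1%R x -> forall n, cell (path x n) y) /\
    (~ L 1%R x -> y = point).
  move=> x; have [x1|nx1] := pselect (L 1%R x); last by exists point.
  by have [y xy] := cell_path_point x1; exists y.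
have mL c : measurable (L c : set (borel cantor_space)) by exact: measurable_below_set.
have mw s : (0 <= a s <= 1)%R /\ (0 <= a s + w s <= 1)%R.
  by have [? ?] := a_bounds s; have := w_ge0 s; split; apply/andP; split; lra.
have f1 s : f @^-1` cell s `&` L 1%R = L (a s + w s)%R `\` L (a s).
  rewrite -pathE; apply/seteqP; split=> x /= [sx x1]; split=> //.
    exact: (@cell_inj _ _ (f x) (size_path _ _) ((fP x).1 x1 _) sx).
  by rewrite -sx; exact: (fP x).1.
have mfcell s : measurable (f @^-1` cell s : set (borel cantor_space)).
  have <- : (f @^-1` cell s `&` L 1%R) `|` (f @^-1` cell s `\` L 1%R) = f @^-1` cell s.
    by rewrite setDE -setIUr setUv setIT.
  apply: measurableU; first by rewrite f1; exact: measurableD.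
  have [sp|nsp] := pselect (cell s point).
    rewrite (_ : _ `\` _ = ~` L 1%R); first exact: measurableC.
    apply/seteqP; split=> [x []//|x nx1]; split=> //=.
    by rewrite (fP x).2.
  rewrite (_ : _ `\` _ = set0)//; apply/seteqP; split=> // x [/= + nx1].
  by rewrite (fP x).2.
have mf : measurable_fun [set: borel cantor_space] (f : _ -> borel T).
  apply: measurable_fun_borel => U oU.
  have -> : f @^-1` U = \bigcup_(s in [set s | cell s `<=` U]) f @^-1` cell s.
    apply/seteqP; split=> [x Ux|x [s sU /sU]//].
    by have [s [sx sU]] := cell_base oU Ux; exists s.
  rewrite bigcup_mkcond; apply: countable_bigcupT_measurable; first exact: countableP.
  by move=> s; case: ifP.
pose F : {mfun borel cantor_space >-> borel T} := mfun_Sub (mem_set mf).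
have FE B : measurable B -> distribution lambda F B = P B.
  pose K := [set B : set (borel T) | B = set0 \/ exists s, B = cell s].
  apply: (@measure_unique _ R (borel T) K (fun=> setT) _ _ _ _ (distribution lambda F) P).
  - apply/seteqP; split; apply: smallest_sub.
    + exact: smallest_sigma_algebra.
    + move=> U oU.
      have -> : U = \bigcup_(s in [set s | cell s `<=` U]) cell s.
        apply/seteqP; split=> [x Ux|x [s sU /sU]//].
        by have [s [sx sU]] := cell_base oU Ux; exists s.
      rewrite bigcup_mkcond.
      apply: (@countable_bigcupT_measurable _ (g_sigma_algebraType K)).
        exact: countableP.
      move=> s; case: ifP => _; last exact: measurable0.
      by apply: sub_sigma_algebra; right; exists s.
    + exact: smallest_sigma_algebra.
    + by move=> A [->|[s ->]]; [exact: measurable0|exact: measurable_cell].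
  - exact: cell_setI_closed.
  - by move=> _; right; exists [::].
  - by apply/seteqP; split=> // x _; exists 0%N.
  - move=> A [->|[s ->]]; first by rewrite !measure0.
    apply: etrans (esym (PE s)); rewrite /distribution /pushforward /=.
    have L1 : lambda (L 1%R) = 1 by rewrite coin_below_set// ler01 lexx.
    apply: etrans (probability_setI_full (mL 1%R) (mfcell s) L1) _.
    have [a01 aw01] := mw s.
    have D : lambda (L (a s + w s)%R `\` L (a s)) =
        lambda (L (a s + w s)%R) - lambda (L (a s + w s)%R `&` L (a s)).
      by apply: measureD => //; exact: le_lt_trans (probability_le1 _ _) (ltry _).
    rewrite f1; apply: etrans D _; rewrite setIidr; last by apply: L_le; rewrite lerDl.
    by rewrite !coin_below_set// -EFinB addrAC subrr add0r.
  - by move=> _; exact: le_lt_trans (probability_le1 _ measurableT) (ltry _).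
exists f => X nX [N [mN N0 XN]]; apply: nX; exists (f @^-1` N); split.
- by rewrite -[X in measurable X]setTI; apply: (mf) => //.
- by apply: etrans N0; exact: (FE N mN).
- by move=> x Xx; apply: XN; exists x.
Qed.

End transport.

(** * Words *)

Section measurable_words.
Context (G : topologicalGroupType) (C : nat -> set G).
Hypotheses (clC : forall n, clopen (C n))
  (baseC : forall U x, open U -> U x -> exists n, C n x /\ C n `<=` U)
  (hG : hausdorff_space G).

(** As [G] has a countable base, multiplication is measurable for the product of the
    Borel sigma-algebras, which is where products of powers of [G] are measured. *)
Lemma measurable_mulg d (X : measurableType d) (f g : X -> borel G) :
  measurable_fun setT f -> measurable_fun setT g ->
  measurable_fun setT (fun x => (f x : G) * g x : borel G)%g.
Proof.
move=> mf mg; apply: measurable_fun_borel => U oU.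
pose D := [set mn : nat * nat | forall y z, C mn.1 y -> C mn.2 z -> U (y * z)%g].
have -> : (fun x => (f x : G) * g x)%g @^-1` U =
    \bigcup_(mn in D) (f @^-1` C mn.1 `&` g @^-1` C mn.2).
  apply/seteqP; split=> [x /= Ux|x [[m n] Dmn [/= fx gx]]]; last exact: Dmn.
  have : nbhs (f x : G, g x : G) ((fun p : G * G => p.1 * p.2)%g @^-1` U).
    by apply: mulg_continuous; exact: open_nbhs_nbhs.
  move=> [[V W] /= [nV nW] VW].
  have [m [Cm CmV]] := baseC (open_interior V) (nbhs_singleton (nbhs_interior nV)).
  have [n [Cn CnW]] := baseC (open_interior W) (nbhs_singleton (nbhs_interior nW)).
  exists (m, n) => // y z /= /CmV/interior_subset Vy /CnW/interior_subset Wz.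
  exact: (VW (y, z)).
rewrite bigcup_mkcond; apply: countable_bigcupT_measurable; first exact: countableP.
move=> [m n]; case: ifP => // _; apply: measurableI.
- rewrite -[X in measurable X]setTI; apply: mf => //; apply: open_borel; exact: (clC m).1.
- rewrite -[X in measurable X]setTI; apply: mg => //; apply: open_borel; exact: (clC n).1.
Qed.

Lemma measurable_invg d (X : measurableType d) (f : X -> borel G) :
  measurable_fun setT f -> measurable_fun setT (fun x => (f x : G)^-1 : borel G)%g.
Proof.
move=> mf; apply: measurable_fun_borel => U oU.
rewrite -[X in measurable X]setTI; apply: (mf measurableT ((fun y : G => y^-1)%g @^-1` U)).
by apply: (@open_borel G); apply: open_comp => // y _; exact: invg_continuous.
Qed.

Lemma measurable_word_eval n (w : word G) :
  measurable_fun setT (fun h : n.-tuple (borel G) => word_eval w (h : seq G) : borel G).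
Proof.
rewrite /word_eval; move: (word_vars w) => vs.
have mnth j : measurable_fun setT
    (fun h : n.-tuple (borel G) => nth 1%g (h : seq G) j : borel G).
  have [jn|nj] := ltnP j n.
    rewrite (_ : (fun h => _) = (@tnth n (borel G))^~ (Ordinal jn)).
      exact: measurable_tnth.
    by apply/funext => h; rewrite (tnth_nth (1%g : G)).
  rewrite (_ : (fun h => _) = cst (1%g : G)); first exact: measurable_cst.
  by apply/funext => h; rewrite nth_default// size_tuple.
elim: w => [|l w IHw].
  under eq_fun do rewrite big_nil.
  exact: measurable_cst.
under eq_fun do rewrite big_cons.
apply: measurable_mulg IHw.
case: l => [g|[i []]]; [exact: measurable_cst|exact: measurable_invg (mnth _)|exact: mnth].
Qed.

Lemma measurable_word_fiber n (w : word G) (g : G) :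
  measurable ([set h : n.-tuple G | word_eval w h = g] : set (n.-tuple (borel G))).
Proof.
rewrite -[X in measurable X]setTI.
apply: (@measurable_word_eval n w measurableT [set g]); apply: closed_borel.
exact: accessible_closed_set1 (hausdorff_accessible hG) g.
Qed.

End measurable_words.

Section instances.
Context (T : eqType) (G : groupType).
Implicit Types (x : T -> G) (u : seq (bool * (T + nat))) (g : G).

Definition inst_letter x (l : bool * (T + nat)) : G + nat * bool :=
  match l with
  | (b, inl t) => inl (if b then (x t)^-1 else x t)%g
  | (b, inr n) => inr (n, b)
  end.

Definition inst x u : word G := map (inst_letter x) u.

Lemma eq_inst (A : set T) x x' u :
  (forall t, A t -> x t = x' t) -> over A u -> inst x u = inst x' u.
Proof.
move=> xx'; elim: u => //= -[b [t|n]] u IHu /= [At /IHu] /=; rewrite /inst /= => ->//.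
by rewrite xx'.
Qed.

(** The word [u(x) g^-1], whose solutions are those of the equation [u(x) = g]. *)
Definition equation x u g : word G := rcons (inst x u) (inl (g^-1)%g).

Definition vars u : seq nat :=
  sort leq (undup (pmap
    (fun l : bool * (T + nat) => if l.2 is inr n then Some n else None) u)).

Lemma mem_vars u n : (n \in vars u) = ((false, inr n) \in u) || ((true, inr n) \in u).
Proof.
rewrite mem_sort mem_undup; elim: u => //= -[b [t|k]] u IHu /=.
  by rewrite IHu !inE !xpair_eqE !andbF.
rewrite !inE IHu !xpair_eqE; case: b => /=; rewrite (inj_eq (@inr_inj _ _)).
  by case: (n == k); rewrite ?orbT ?orbF.
by case: (n == k); rewrite ?orbT ?orbF.
Qed.

Lemma word_vars_inst x u : word_vars (inst x u) = vars u.
Proof.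
by congr (sort _ (undup _)); elim: u => //= -[b [t|n]] u /= ->.
Qed.

Lemma word_vars_equation x u g : word_vars (equation x u g) = vars u.
Proof.
by rewrite -(word_vars_inst x) /word_vars /equation -cats1 pmap_cat cats0.
Qed.

Definition letter_value x (vs : seq nat) (h : seq G) (l : bool * (T + nat)) : G :=
  let v := match l.2 with inl t => x t | inr n => nth 1%g h (index n vs) end in
  if l.1 then (v^-1)%g else v.

Lemma word_eval_inst x u h : word_eval (inst x u) h =
  (\big[*%g/1]_(l <- u) letter_value x (vars u) h l)%g.
Proof.
rewrite /word_eval word_vars_inst /inst big_map; apply: eq_bigr => -[[] [t|n]] _ //.
Qed.

Lemma word_eval_equation x u g h : (word_eval (equation x u g) h = 1 <->
  word_eval (inst x u) h = g)%g.
Proof.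
have -> : word_eval (equation x u g) h = (word_eval (inst x u) h * g^-1)%g.
  rewrite /word_eval word_vars_equation word_vars_inst /equation -cats1 big_cat/=.
  by rewrite big_seq1.
by split=> [/(congr1 (fun z => z * g)%g)|->]; rewrite ?mulgVK ?mul1g ?mulgV.
Qed.

(** Letters for the constant [x t] become letters for the new variable [x_m]. *)
Definition abstract_letter t m (l : bool * (T + nat)) : bool * (T + nat) :=
  if l.2 == inl t then (l.1, inr m) else l.

Section abstraction.
Variables (t : T) (m : nat) (u : seq (bool * (T + nat))).
Hypothesis vars_m : forall n, n \in vars u -> (n < m)%N.
Hypothesis tu : (false, inl t) \in u \/ (true, inl t) \in u.

Let u' := map (abstract_letter t m) u.

Lemma vars_abstract : vars u' = rcons (vars u) m.
Proof.
have mu : m \notin vars u by apply/negP => /vars_m; rewrite ltnn.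
apply: (sorted_eq leq_trans anti_leq); first exact: (sort_sorted leq_total).
  rewrite (sorted_pairwise leq_trans) pairwise_rcons -(sorted_pairwise leq_trans).
  rewrite (sort_sorted leq_total) andbT; apply/allP => n /vars_m; exact: ltnW.
apply: uniq_perm.
- by rewrite sort_uniq undup_uniq.
- by rewrite rcons_uniq mu sort_uniq undup_uniq.
have mem_u' b n : ((b, inr n) \in u') =
    ((b, inr n) \in u) || ((b, inl t) \in u) && (n == m).
  apply/mapP/orP => [[[b' v] lu]|[lu|/andP[lu /eqP ->]]].
  - rewrite /abstract_letter /=; case: eqP => [vt|_] [-> e]; last by left; rewrite e.
    by right; rewrite -vt lu /= e.
  - by exists (b, inr n).
  - by exists (b, inl t) => //; rewrite /abstract_letter /= eqxx.
move=> n; rewrite mem_rcons inE !mem_vars !mem_u'.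
have [->|nm] := eqVneq n m; last by rewrite !andbF !orbF.
by case: tu => ->; rewrite !andbT ?orbT.
Qed.

(** The variable [m] comes last, so that its value is appended to [h], as in the
    fibers of a Markov set. *)
Lemma word_eval_abstract x (h : seq G) : size h = size (vars u) ->
  word_eval (inst x u') (rcons h (x t)) = word_eval (inst x u) h.
Proof.
move=> hu; rewrite !word_eval_inst vars_abstract big_map.
apply: eq_big_seq => -[b [t'|n]] lu; rewrite /abstract_letter /letter_value /=.
  case: eqP => [[->]|//] /=; rewrite -(cats1 (vars u)) index_cat.
  have /negbTE -> : m \notin vars u by apply/negP => /vars_m; rewrite ltnn.
  by rewrite /= eqxx addn0 nth_rcons hu ltnn eqxx.
have nu : n \in vars u by rewrite mem_vars; case: b lu => -> ; rewrite ?orbT.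
by rewrite -(cats1 (vars u)) index_cat nu nth_rcons hu index_mem nu.
Qed.

End abstraction.

End instances.

(** * Equations with null solution sets *)

Lemma over_imp T (A B : set T) u : A `<=` B -> over A u -> over B u.
Proof.
move=> AB; elim: u => //= -[b [t|n]] u IHu [/= At /IHu]; split=> //; exact: AB.
Qed.

Lemma over_cat T (A : set T) u v : over A u -> over A v -> over A (u ++ v).
Proof. by elim: u => //= l u IHu [? Au] Av; split=> //; exact: IHu. Qed.

Section null_equations.
Context (R : realType) (G : topologicalGroupType) (mu : probability (borel G) R)
  (C : nat -> set G).
Hypotheses (clC : forall n, clopen (C n))
  (baseC : forall U x, open U -> U x -> exists n, C n x /\ C n `<=` U)
  (hG : hausdorff_space G).
Context (T : eqType).
Implicit Types (x : T -> G) (u : seq (bool * (T + nat))) (g : G).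

Definition solutions x u g n : set (n.-tuple G) :=
  [set h : n.-tuple G | word_eval (inst x u) (h : seq G) = g].

Definition null_equation x u g :=
  (power_measure mu (size (vars u))).-negligible (solutions x u g (n := _)).

(** The Fubini-Markov set of the word [u(x) g^-1]: the values of its last variable
    that leave an equation, in the other variables, whose solution set is not
    null. *)
Definition critical x u g : set G :=
  if (size (vars u)).-1 is n.+1
  then [set y | 0 < power_measure mu n.+1 (fiber (solutions x u g (n := n.+2)) y)]
  else [set y | solutions x u g [tuple y]].

Lemma eq_critical (A : set T) x x' u g :
  (forall t, A t -> x t = x' t) -> over A u -> critical x u g = critical x' u g.
Proof. by move=> xx' Au; rewrite /critical /solutions (eq_inst xx' Au). Qed.

Lemma solutionsE x u g n :
  solutions x u g (n := n) = [set h : n.-tuple G | word_eval (equation x u g) h = 1%g].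
Proof. by apply/seteqP; split=> h /word_eval_equation. Qed.

Lemma critical_fubini_markov x u g : (0 < size (vars u))%N ->
  null_equation x u g -> is_fubini_markov mu (critical x u g).
Proof.
rewrite /null_equation /critical; case un : (size (vars u)) => [|[|n]]//= _ null.
  left; exists (solutions x u g (n := 1)) => //; split=> //; rewrite solutionsE.
  by exists (equation x u g); rewrite /word_arity word_vars_equation un.
right; exists n.+1, (solutions x u g (n := n.+2)); split=> //; split=> //.
by rewrite solutionsE; exists (equation x u g); rewrite /word_arity word_vars_equation un.
Qed.

Lemma measure0_solutions x u g n : ~ (0 < power_measure mu n (solutions x u g (n := n))) ->
  (power_measure mu n).-negligible (solutions x u g (n := n)).
Proof.
move=> n0; apply/negligibleP; first exact: measurable_word_fiber.
by apply/eqP; rewrite -measure_le0 leNgt; exact/negP.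
Qed.

(** If [x t] avoids the critical set of the equation where [x t] is replaced by a
    new last variable, then the original equation, whose solution set is a fiber of
    the other one, has a null solution set too. *)
Lemma null_equation_abstract t m x u g :
  (forall n, n \in vars u -> (n < m)%N) ->
  ((false, inl t) \in u \/ (true, inl t) \in u) ->
  ~ critical x (map (abstract_letter t m) u) g (x t) -> null_equation x u g.
Proof.
move=> um tu; rewrite /critical /null_equation vars_abstract// size_rcons /=.
have fiberE n (h : n.-tuple G) : n = size (vars u) ->
    solutions x (map (abstract_letter t m) u) g [tuple of rcons h (x t)] ->
    solutions x u g h.
  by move=> hn; rewrite /solutions /= word_eval_abstract// size_tuple.
have fiberE' n (h : n.-tuple G) : n = size (vars u) -> solutions x u g h ->
    solutions x (map (abstract_letter t m) u) g [tuple of rcons h (x t)].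
  by move=> hn; rewrite /solutions /= word_eval_abstract// size_tuple.
move: fiberE fiberE'; case: (size (vars u)) => [|n] fiberE fiberE' ncrit.
  rewrite (_ : solutions x u g (n := 0) = set0); first exact: negligible_set0.
  apply/seteqP; split=> // h /(fiberE' _ _ erefl); apply: contra_not ncrit => ncrit.
  by rewrite tuple0 in ncrit; move: ncrit; rewrite /solutions.
apply: measure0_solutions; apply: contra_not ncrit.
suff -> : solutions x u g (n := n.+1) =
  fiber (solutions x (map (abstract_letter t m) u) g (n := n.+2)) (x t) by [].
by apply/seteqP; split=> h; [exact: fiberE'|exact: fiberE].
Qed.

(** For each of the countably many words [w] without constants, the equations
    [w = g] have disjoint solution sets, so that only countably many of these have
    positive measure. It remains to choose in each basic open set a point outside
    of the countable set of these [g]. *)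
Lemma generic_constants :
  (forall A : set G, countable A -> forall U : set G, open U -> U !=set0 ->
    exists2 g, U g & ~ A g) ->
  exists g : nat -> G, (forall U, open U -> U !=set0 -> exists k, U (g k)) /\
    forall k x u, over set0 u -> null_equation x u (g k).
Proof.
move=> avoid; pose word0 (v : seq (nat * bool)) : word G := map inr v.
pose Q := \bigcup_v [set g | 0 < power_measure mu (word_arity (word0 v))
  [set h : (word_arity (word0 v)).-tuple G | word_eval (word0 v) (h : seq G) = g]].
have cQ : countable Q.
  apply: bigcup_countable => [|v _]; first exact: countableP.
  apply: measurable_fibers_gt0_countable => g; exact: measurable_word_fiber.
have /choice[g gP] : forall k, exists g, C k !=set0 -> C k g /\ ~ Q g.
  move=> k; have [Ck|nCk] := pselect (C k !=set0); last by exists 1%g.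
  by have [g Cg nQg] := avoid _ cQ _ (clC k).1 Ck; exists g.
have [k0 Ck0] : exists k, C k !=set0.
  by have [k [Ck _]] := baseC openT (I : [set: G] 1%g); exists k; exists 1%g.
pose g' k := if `[< C k !=set0 >] then g k else g k0.
exists g'; split=> [U oU [y Uy]|k x u u0].
  have [k [Cky CU]] := baseC oU Uy.
  have Ck : C k !=set0 by exists y.
  by exists k; rewrite /g' asboolT//; apply: CU; have [] := gP k Ck.
have nQ : ~ Q (g' k) by rewrite /g'; case: asboolP => [/gP[]//|_]; have [] := gP k0 Ck0.
have [v uv] : exists v, inst x u = word0 v.
  elim: u u0 => [|[b [t|n]] u IHu]//=; first by exists [::].
    by case.
  by move=> [_ /IHu[v uv]]; exists ((n, b) :: v); rewrite /inst /= -/(inst x u) uv.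
apply: measure0_solutions; apply: contra_not nQ => pos; exists v => //=.
by move: pos; rewrite /solutions /word_arity -uv word_vars_inst.
Qed.

Section generic_sequence.
Variables (lt : T -> T -> Prop) (g : nat -> G) (x : T -> G).
Hypotheses (wf : well_founded lt)
  (lt_trans : forall r s t, lt r s -> lt s t -> lt r t)
  (lt_total : forall s t, [\/ lt s t, s = t | lt t s])
  (null0 : forall k u, over set0 u -> null_equation x u (g k)).

(** The constants of a word are turned into variables from the last one, for the
    well-order [lt], to the first. *)
Lemma over_last (A : set T) u : over A u -> over set0 u \/
  exists t, [/\ A t, (false, inl t) \in u \/ (true, inl t) \in u &
    over [set s | A s /\ (s = t \/ lt s t)] u].
Proof.
elim: u => [|[b [s|n]] u IHu] /=; first by left.
  move=> [As /IHu[u0|[t [At tu ut]]]]; right.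
    exists s; split=> //; first by rewrite !inE; case: b; [right|left]; rewrite eqxx.
    by split; [split=> //; left|apply: over_imp u0].
  have [st|st|ts] := lt_total s t.
  - exists t; split=> //; first by rewrite !inE; case: tu => ->; rewrite orbT; [left|right].
    by split=> //; split=> //; right.
  - exists t; split=> //; first by rewrite !inE; case: tu => ->; rewrite orbT; [left|right].
    by split=> //; split=> //; left.
  - exists s; split=> //; first by rewrite !inE; case: b; [right|left]; rewrite eqxx.
    split; first by split=> //; left.
    apply: over_imp ut => r [Ar [->|rt]]; split=> //; right=> //.
    exact: lt_trans rt ts.
move=> [_ /IHu[u0|[t [At tu ut]]]]; [by left|right].
by exists t; split=> //; rewrite !inE; case: tu => ->; rewrite orbT; [left|right].
Qed.

Lemma over_abstract (A : set T) t m u :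
  over [set s | A s /\ (s = t \/ lt s t)] u ->
  over [set s | A s /\ lt s t] (map (abstract_letter t m) u).
Proof.
elim: u => //= -[b [s|n]] u IHu [/= As /IHu]; rewrite /abstract_letter /=.
  by case: eqP => [//|st] ?; split=> //=; case: As => As [e|//]; case: st; rewrite e.
by [].
Qed.

(** By induction along [lt]: the last constant [x t] of a word is replaced by a new
    variable, which leaves a word over the constants before [t], and [x t] avoids
    the critical set of this word. *)
Lemma generic_null_equation (A : set T) :
  (forall t k u, A t -> over [set s | A s /\ lt s t] u ->
    is_fubini_markov mu (critical x u (g k)) -> ~ critical x u (g k) (x t)) ->
  forall k u, over A u -> null_equation x u (g k).
Proof.
move=> avoid.
have step B k u : B `<=` A ->
    (forall t, B t -> forall v, over [set s | A s /\ lt s t] v ->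
      null_equation x v (g k)) ->
    over B u -> null_equation x u (g k).
  move=> BA nullB /over_last[/null0//|[t [Bt tu ut]]].
  have [m um] : exists m, forall n, n \in vars u -> (n < m)%N.
    exists (\max_(n <- vars u) n).+1 => n nu; rewrite ltnS.
    by rewrite (big_rem n nu) leq_maxl.
  have ut' : over [set s | A s /\ lt s t] (map (abstract_letter t m) u).
    by apply: over_abstract; apply: over_imp ut => s [/BA].
  apply: (null_equation_abstract um tu); apply: (avoid t) => //; first exact: BA.
  apply: critical_fubini_markov; first by rewrite vars_abstract// size_rcons.
  exact: (nullB t).
have lower k : forall t, A t -> forall v, over [set s | A s /\ lt s t] v ->
    null_equation x v (g k).
  move=> t; elim/(well_founded_ind wf): t => t IHt At v.
  by apply: step => [s []//|s [As st]]; exact: IHt.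
by move=> k u; apply: step => //; exact: lower.
Qed.

End generic_sequence.

End null_equations.

(** * The subgroup generated by a family *)

Section generated_subgroup.
Context (T : eqType) (G : groupType) (x : T -> G) (A : set T).
Implicit Types (u : seq (bool * (T + nat))) (t : T).

(** The elements of the subgroup are the values of the words without variables; the
    empty assignment is a placeholder. *)
Definition generated : set G := [set y | exists u,
  [/\ over A u, vars u = [::] & y = word_eval (inst x u) [::]]].

Lemma generated_mem t : A t -> generated (x t).
Proof.
move=> At; exists [:: (false, inl t)]; split=> //.
by rewrite word_eval_inst big_seq1.
Qed.

Let inv_letter (l : bool * (T + nat)) := (~~ l.1, l.2).

Let inv_inst u : exists v, [/\ over A u -> over A v, vars u = [::] -> vars v = [::] &
  word_eval (inst x v) [::] = (word_eval (inst x u) [::])^-1%g].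
Proof.
pose v := rev (map inv_letter u).
have mem_v b n : ((b, inr n) \in v) = ((~~ b, inr n) \in u).
  rewrite /v mem_rev; apply/mapP/idP => [[[c l] lu [-> ->]]|lu]; first by rewrite negbK.
  by exists (~~ b, inr n) => //; rewrite /inv_letter /= negbK.
have letter_nil w l : letter_value x w [::] l = letter_value x [::] [::] l.
  by case: l => [b [t|n]] //; rewrite /letter_value /= !nth_nil.
exists v; split.
- rewrite /v; elim: u {v mem_v} => //= l u IHu [Al /IHu Au].
  by rewrite rev_cons -cats1; apply: over_cat => //; split.
- move=> u0; apply/nilP; rewrite /nilp -leqn0 leqNgt; apply/negP => v0.
  have /= := mem_nth 0%N v0; move: (nth _ _ _) => n.
  by rewrite mem_vars !mem_v /= orbC -mem_vars u0.
- rewrite !word_eval_inst /v.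
  under eq_bigr do rewrite letter_nil.
  under [in RHS]eq_bigr do rewrite letter_nil.
  elim: u {v mem_v} => [|l u IHu]; first by rewrite !big_nil invg1.
  rewrite /= rev_cons -cats1 big_cat big_seq1 IHu big_cons invgM /=; congr (_ * _)%g.
  by rewrite /letter_value /inv_letter /=; case: (l.1) => //=; rewrite invgK.
Qed.

Lemma group_closed_generated : group_closed (mem generated).
Proof.
split.
  by apply/mem_set; exists [::]; split=> //; rewrite word_eval_inst big_nil.
move=> y z /set_mem[u [Au u0 ->]] /set_mem[v [Av v0 ->]]; apply/mem_set.
have [w [Aw w0 wE]] := inv_inst v; exists (u ++ w); split.
- exact/(over_cat Au)/Aw.
- apply/nilP; rewrite /nilp -leqn0 leqNgt; apply/negP => uw0.
  have := mem_nth 0%N uw0; move: (nth _ _ _) => n.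
  rewrite mem_vars !mem_cat orbACA -!mem_vars u0 w0//.
rewrite -wE !word_eval_inst big_cat/=; congr (_ * _)%g.
  by apply: eq_bigr => -[b [t|n]] _ //; rewrite /letter_value /= !nth_nil.
by apply: eq_bigr => -[b [t|n]] _ //; rewrite /letter_value /= !nth_nil.
Qed.

End generated_subgroup.

(** * Non-measurable subgroups *)

(** The condition on [x t] depends only on the values of [x] before [t]: it may be
    tested on these values, extended by an arbitrary one. *)
Lemma wf_recursive_choice (T : Type) (Y : pointedType) (lt : T -> T -> Prop)
    (Phi : T -> (T -> Y) -> Y -> Prop) : well_founded lt ->
  (forall t x, exists y, Phi t x y) ->
  (forall t x x' y, (forall s, lt s t -> x s = x' s) -> Phi t x y -> Phi t x' y) ->
  exists x, forall t, Phi t x (x t).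
Proof.
move=> wf total local_Phi.
have /choice[c cP] : forall tx : T * (T -> Y), exists y, Phi tx.1 tx.2 y.
  by move=> [t x]; exact: total.
pose extend t (r : forall s, lt s t -> Y) s :=
  if pselect (lt s t) is left st then r s st else point.
pose F t (r : forall s, lt s t -> Y) := c (t, extend t r).
pose x := Fix wf (fun=> Y) F.
exists x => t; have -> : x t = F t (fun s _ => x s).
  apply: (Fix_eq wf (fun=> Y) F) => s r r' rr'; congr (c (s, _)).
  by apply/funext => s'; rewrite /extend; case: pselect => // ?; exact: rr'.
apply: local_Phi (cP (t, _)) => s st; rewrite /= /extend; case: pselect => //.
Qed.

(** By regularity every null set is contained in a null [G_delta] set; it is coded
    by telling, for each of the open sets of which it is the intersection, which
    basic open sets this open set contains. *)
Lemma null_sets_coded (R : realType) (T : ptopologicalType) (C : nat -> set T)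
    (P : probability (borel T) R) : (forall n, clopen (C n)) ->
    (forall U x, open U -> U x -> exists n, C n x /\ C n `<=` U) ->
  exists N : (nat -> nat -> bool) -> set T,
    (forall c, P.-negligible (N c)) /\
    forall X, P.-negligible X -> exists c, X `<=` N c.
Proof.
move=> clC baseC.
pose D (c : nat -> nat -> bool) : set T := \bigcap_n \bigcup_(m in [set m | c n m]) C m.
exists (fun c => if `[< P.-negligible (D c) >] then D c else set0).
split=> [c|X [B [mB B0 XB]]].
  by case: asboolP => // _; exact: negligible_set0.
have /choice[U UP] : forall n, exists U : set T,
    [/\ open U, B `<=` U & P U <= (n.+1%:R^-1)%:E].
  move=> n; have n0 : (0 < n.+1%:R^-1 :> R)%R by rewrite invr_gt0.
  have [F [U [cF oU FB BU UF]]] := borel_regular clC baseC P mB n0.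
  exists U; split=> //; apply: le_trans UF.
  have mF := closed_borel cF; have mU := open_borel oU.
  have mUF : measurable (U `\` F : set (borel T)) by exact: measurableD.
  have F0 : P F = 0.
    apply/eqP; rewrite -measure_le0 -[leRHS]B0.
    by apply: le_measure => [||//]; exact/mem_set.
  rewrite -[leRHS]add0e -[X in X + _]F0; apply: le_trans (measureU2 _ mF mUF).
  apply: le_measure; [exact/mem_set|exact/mem_set/measurableU|].
  by move=> y Uy; have [|] := pselect (F y); [left|right].
pose c n m := `[< C m `<=` U n >].
have DU n : \bigcup_(m in [set m | c n m]) C m = U n.
  have [oU _ _] := UP n; rewrite [RHS](open_bigcup_base baseC oU).
  by apply/seteqP; split=> y [m /asboolP mU Cy]; exists m => //; exact/asboolP.
have DE : D c = \bigcap_n U n by apply: eq_bigcapr => n _; exact: DU.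
have mD : measurable (D c : set (borel T)).
  rewrite DE; apply: bigcap_measurableType => n _; apply: open_borel; by have [] := UP n.
exists c; rewrite asboolT; last first.
  apply/negligibleP => //; apply/eqP; rewrite -measure_le0.
  apply/lee_addgt0Pr => e e0; rewrite add0e.
  have [n ne] := ltr_add_invr e0; rewrite add0r in ne.
  have [oU _ Un] := UP n; apply: le_trans (le_trans Un _); last by rewrite lee_fin ltW.
  apply: le_measure; [exact/mem_set|exact: mem_set (open_borel oU)|].
  by rewrite DE; exact: bigcap_inf.
move=> y /XB By; rewrite DE => n _; have [_ BU _] := UP n; exact: BU.
Qed.

Section nonmeasurable.
Context (R : realType) (G : topologicalGroupType) (mu : probability (borel G) R)
  (lambda : probability (borel cantor_space) R).
Hypotheses (G_infinite : infinite_set [set: G]) (G_metrizable : metrizable R G)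
  (G_profinite : profinite G) (mu_haar : is_haar mu) (lambda_coin : is_coin_measure lambda).

(** The image in [G] of a non-null set of the Cantor space with less than continuum
    many elements generates a subgroup that is not null. If it were measurable, it
    would contain an open set, finitely many translates of which cover [G]; but it
    is too small for that. *)
Lemma nonmeasurable_small (A : set cantor_space) : ~ lambda.-negligible A ->
  ~ ([set: cantor_space] #<= A) ->
  exists H : set G, group_closed (mem H) /\ ~ is_haar_measurable mu H.
Proof.
move=> nA smallA; have [C [clC baseC]] := profinite_clopen_base G_metrizable G_profinite.
have [cptG hG _] := G_profinite.
have [f fA] := coin_transport mu lambda_coin cptG clC baseC.
exists (generated f A); split; first exact: group_closed_generated.
move=> /(haar_measurable_subgroup G_metrizable G_profinite mu_haar
  (group_closed_generated f A)).
case.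
  move=> H0; apply: (fA _ nA); apply: negligibleS H0 => _ [t At <-].
  exact: generated_mem.
move=> V [oV V1 VH]; apply: smallA; apply: (card_le_over uncountable_cantor).
apply: card_le_trans (card_ge_cantor_group G_infinite G_metrizable G_profinite) _.
move: cptG; rewrite compact_cover.
move=> /(_ G setT (fun y => [set (y * a)%g | a in V])) [||D _ GD].
- by move=> y _; exact: open_image_lmulg.
- by move=> y _; exists y => //; exists 1%g => //; rewrite mulg1.
(* A point of [G] is coded by the index of a translate and a word. *)
pose s := finmap.enum_fset D.
apply: (@card_le_rel _ _ _ _ (fun z l => exists i u, l = (false, inr i) :: u /\
    z = (nth 1 s i * word_eval (inst f u) [::])%g)) => [z _|z z' l _ _].
  have [y yD [a /VH[u [Au _ ->]] <-]] := GD z I.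
  exists ((false, inr (index y s)) :: u); first by split.
  by exists (index y s), u; rewrite nth_index.
by move=> [i [u [-> ->]]] [j [v [[<- <-] ->]]].
Qed.

(** By recursion along a well-order of the continuum with small initial segments,
    choose [x t] outside of the [t]-th null set and of the critical sets of the
    equations over the previous elements: these sets are too few for their union
    to have full measure, so that its complement is not contained in a null set.
    The subgroup generated by the [x t] is not null, and it omits the generic
    constants [g k], which are dense; hence it has no interior point. *)
Lemma nonmeasurable_continuum :
  (forall F, fubini_markov_covers mu F -> [set: cantor_space] #<= F) ->
  exists H : set G, group_closed (mem H) /\ ~ is_haar_measurable mu H.
Proof.
move=> big_cover; have [C [clC baseC]] := profinite_clopen_base G_metrizable G_profinite.
have [_ hG _] := G_profinite.
have [P [lt [wf lt_trans lt_total bigP smallP]]] :=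
  @initial_well_order cantor_space _ [set: cantor_space] (card_lexx _).
have [N [N0 NN]] := null_sets_coded mu clC baseC.
have /pcard_surjP[code code_surj] := card_le_trans cantor_sequences bigP.
have [|g [g_dense g_null]] := @generic_constants R G mu C clC baseC hG cantor_space.
  move=> A cA U oU U0; apply: contrapT => UA.
  have /negligibleP UA0 : mu.-negligible U.
    apply: negligibleS (haar_countable G_infinite G_metrizable G_profinite mu_haar cA).
    by move=> y Uy; apply: contrapT => nAy; apply: UA; exists y.
  have := haar_open_gt0 G_profinite mu_haar oU U0.
  by rewrite UA0 ?ltxx//; exact: open_borel.
(* The Fubini-Markov sets to avoid at stage [t]. *)
pose crit (x : cantor_space -> G) t := [set M | exists k u,
  [/\ over [set s | P s /\ lt s t] u, M = critical mu x u (g k) & is_fubini_markov mu M]].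
pose Phi t x y := P t -> ~ N (code t) y /\ forall M, crit x t M -> ~ M y.
have [||x xP] := @wf_recursive_choice cantor_space G lt Phi wf.
- move=> t x; have [Pt|nPt] := pselect (P t); last by exists point.
  have crit_le : crit x t #<= over [set s | P s /\ lt s t].
    pose h (l : seq (bool * (cantor_space + nat))) :=
      if l is (_, inr k) :: u then critical mu x u (g k) else set0.
    apply: card_le_trans (card_image_le h _).
    apply: subset_card_le => M [k [u [ut -> _]]].
    by exists ((false, inr k) :: u).
  have : ~ fubini_markov_covers mu (crit x t).
    move=> /big_cover cov; apply: (smallP t Pt); apply: card_le_over uncountable_cantor _.
    exact: card_le_trans cov crit_le.
  apply: contra_notP => /forallNP nPhi; split=> [M [k [u []]]//|].
  apply: negligibleS (N0 (code t)) => y ny; apply: contrapT => nNy.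
  apply: (nPhi y) => _; split=> // M cM My; apply: ny; by exists M.
- move=> t x x' y xx' Phix Pt; have [nN ncrit] := Phix Pt; split; first exact: nN.
  move=> M [k [u [ut ME FM]]]; apply: ncrit; exists k, u; split; [exact: ut| |exact: FM].
  by rewrite ME; apply: esym; apply: eq_critical ut => s [_]; exact: xx'.
have nullP : forall k u, over P u -> null_equation mu x u (g k).
  apply: (generic_null_equation clC baseC hG wf lt_trans lt_total).
    by move=> k u; exact: g_null.
  move=> t k u Pt ut FM; have [_ ncrit] := xP t Pt; apply: ncrit.
  by exists k, u.
exists (generated x P); split; first exact: group_closed_generated.
move=> /(haar_measurable_subgroup G_metrizable G_profinite mu_haar
  (group_closed_generated x P)).
case.
  move=> /NN[c Hc]; have [t Pt ct] := code_surj c I.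
  have [nN _] := xP t Pt; apply: nN; rewrite ct; apply: Hc; exact: generated_mem.
move=> V [oV V1 VH]; have [|k Vk] := g_dense V oV; first by exists 1%g.
have [u [Pu u0 gu]] := VH _ Vk.
have := nullP k u Pu; rewrite /null_equation u0 => -[B [mB + solB]].
have B0 : B [tuple] by apply: solB; exact: esym gu.
by rewrite /= diracE mem_set// => /eqP; rewrite onee_eq0.
Qed.

End nonmeasurable.

Local Close Scope ereal_scope.
Local Close Scope card_scope.

Theorem theorem7 (R : realType) (G : topologicalGroupType)
    (mu : probability (borel G) R)
    (lambda : probability (borel cantor_space) R)
    (G_infinite : infinite_set [set: G])
    (G_metrizable : metrizable R G)
    (G_profinite : profinite G)
    (mu_haar : is_haar mu)
    (lambda_coin : is_coin_measure lambda)
    (non_le_fm : min_card_le (nonnull_sets lambda) (fubini_markov_covers mu)) :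
  exists H : set G, group_closed (mem H) /\ ~ is_haar_measurable mu H.
Proof.
have [A [B [[nA _] [_ minB] AB]]] := non_le_fm.
have [bigA|smallA] := pselect ([set: cantor_space] #<= A)%card.
  apply: nonmeasurable_continuum => // F /minB.
  exact/card_le_trans/(card_le_trans bigA AB).
exact: nonmeasurable_small nA smallA.
Qed.
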